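(* Let $\epsilon,\delta$ be nonnegative real numbers with $\epsilon<\frac{1}{12}$ and $\delta<\frac{(1-12\epsilon)^2}{10409}$. Then for every positive integer $n$, every $\epsilon$-dense partial Latin square $P$ of order $n$ containing no more than $\delta n^2$ filled cells in total is completable.
   Context: A Latin square of order $n$ is an $n\times n$ array filled with symbols from $\{1,\dots,n\}$ such that no symbol is repeated in any row or column. A partial Latin square of order $n$ is an $n\times n$ array in which each cell is either blank or contains one symbol from $\{1,\dots,n\}$, such that no symbol is repeated in any row or column. It is completable if its blank cells can be filled so that the resulting array is a Latin square. A partial Latin square of order $n$ is $\epsilon$-dense if each row contains at most $\epsilon n$ filled (nonblank) cells, each column contains at most $\epsilon n$ filled cells, and each symbol occurs in at most $\epsilon n$ cells. *)

(* Defs.v *)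
From mathcomp Require Import all_boot all_order all_algebra.
From mathcomp Require Import reals.

Set Implicit Arguments.
Unset Strict Implicit.
Unset Printing Implicit Defensive.

Import Order.TTheory GRing.Theory Num.Theory.
Local Open Scope ring_scope.

(* Rows, columns and symbols are all indexed by 'I_n, i.e. the symbols
   1, ..., n are relabelled 0, ..., n - 1; a blank cell contains None. *)
Definition latin_square (n : nat) (L : 'M['I_n]_n) : Prop :=
  (forall i j1 j2, L i j1 = L i j2 -> j1 = j2) /\
  (forall j i1 i2, L i1 j = L i2 j -> i1 = i2).

Definition partial_latin_square (n : nat) (P : 'M[option 'I_n]_n) : Prop :=
  (forall i j1 j2 s, P i j1 = Some s -> P i j2 = Some s -> j1 = j2) /\
  (forall j i1 i2 s, P i1 j = Some s -> P i2 j = Some s -> i1 = i2).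

Definition completable (n : nat) (P : 'M[option 'I_n]_n) : Prop :=
  exists L : 'M['I_n]_n,
    latin_square L /\ (forall i j s, P i j = Some s -> L i j = s).

Definition filled_cells (n : nat) (P : 'M[option 'I_n]_n) :
    {set 'I_n * 'I_n} :=
  [set c | P c.1 c.2 != None].

Definition eps_dense (R : realType) (eps : R) (n : nat)
    (P : 'M[option 'I_n]_n) : Prop :=
  [/\ forall i : 'I_n, #|[set j | P i j != None]|%:R <= eps * n%:R,
      forall j : 'I_n, #|[set i | P i j != None]|%:R <= eps * n%:R
    & forall s : 'I_n,
        #|[set c : 'I_n * 'I_n | P c.1 c.2 == Some s]|%:R <= eps * n%:R].

(* Main.v *)
Require Import Defs.
From mathcomp Require Import all_boot all_order all_fingroup all_algebra.
From mathcomp Require Import reals.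
From mathcomp Require Import zify ring.

Set Implicit Arguments.
Unset Strict Implicit.
Unset Printing Implicit Defensive.

(** Let N be the number of filled cells and e the maximal number of filled cells
in a line. If 2N <= n, the filled cells lie in an A x B array with
#|A| + #|B| <= n; it is filled greedily and completed by Ryser's theorem.

If 2N > n, then n is large. Start from a Latin square that agrees, outside at
most 3n cells, with the table of a dihedral group, so that an undisturbed cell
lies in about n/2 intercalates, and correct the cells of P one by one. To put s
into the cell (r, c) holding a, choose a row x and let z be the column of a in
row x. Move the s of row r to column z and the s of column c to row x by two
disjoint trades, then switch the intercalate on rows r, x and columns c, z. Each
of the two moves is a composition of intercalate switches; besides z it has a
second free parameter y, and apart from a few cells lying on the heavily used
lines r, c and s, each cell that it touches is an injective function of (z, y) or
of one of its parameters together with a third one. Averaging over the parameters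
therefore finds a trade of at most 64 cells avoiding all cells disturbed so far
where this is needed; on the lines through (r, c, s) only the at most e cells
that are already correct are avoided. *)

(** * Hall's theorem *)

Section Hall.
Variable T : finType.

Definition nbhd (e : rel T) (X : {set T}) : {set T} :=
  [set y | [exists x in X, e x y]].

(** Halmos and Vaughan's induction. If some proper nonempty subset X is tight, X and the rest are
    matched separately, the rest outside the neighbourhood of X. Otherwise every such subset has a
    surplus, so any edge at a can be fixed and its endpoint b removed. *)
Lemma hall_on (e : rel T) (X0 : {set T}) :
  (forall X : {set T}, X \subset X0 -> #|X| <= #|nbhd e X|) ->
  exists f : T -> T, {in X0 &, injective f} /\ {in X0, forall x, e x (f x)}.
Proof.
move: {2}#|X0| (leqnn #|X0|) => N; elim: N e X0 => [|N IH] e X0.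
  rewrite leqn0 cards_eq0 => /eqP-> _; exists id.
  by split=> x; rewrite in_set0.
move=> leN hall.
have [->|[a aX0]] := set_0Vmem X0.
  by exists id; split=> x; rewrite in_set0.
have [tight|loose] := boolP [exists X : {set T},
    [&& X \proper X0, X != set0 & #|nbhd e X| <= #|X| ] ].
  case/existsP: tight => X /and3P[propX nzX tX].
  have subX := proper_sub propX; have ltX := proper_card propX.
  have [f1 [inj1 e1]] : exists f : T -> T,
      {in X &, injective f} /\ {in X, forall x, e x (f x)}.
    by apply: (IH e) => [|Y sY]; [lia | apply: hall; apply: subset_trans sY _].
  pose e' x y := e x y && (y \notin nbhd e X).
  have [f2 [inj2 e2]] : exists f : T -> T,
      {in X0 :\: X &, injective f} /\ {in X0 :\: X, forall x, e' x (f x)}.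
    apply: (IH e') => [|Y sY].
      by rewrite cardsD (setIidPr subX); have := card_gt0 X; rewrite nzX; lia.
    have dYX : Y :&: X = set0.
      apply/setP=> x; rewrite !inE; apply/negP=> /andP[/(subsetP sY)].
      by rewrite inE => /andP[/negP].
    have := hall (Y :|: X).
    rewrite subUset subX (subset_trans sY (subsetDl _ _)) => /(_ isT).
    rewrite cardsU dYX cards0 subn0 => hYX.
    have : #|nbhd e (Y :|: X)| <= #|nbhd e' Y :|: nbhd e X|.
      apply: subset_leq_card; apply/subsetP=> y; rewrite !inE.
      case/existsP=> x /andP[]; rewrite inE => /orP[] xY exy; last first.
        by apply/orP; right; apply/existsP; exists x; rewrite xY.
      have [yX|yX] := boolP [exists x0 in X, e x0 y]; first by rewrite orbT.
      rewrite orbF; apply/existsP; exists x; rewrite xY /e' exy.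
      by rewrite inE.
    have := leq_card_setU (nbhd e' Y) (nbhd e X); case=> lecU _; lia.
  have f2X y : y \in X0 :\: X -> f2 y \notin nbhd e X.
    by move/e2 => /andP[].
  have f1X x : x \in X -> f1 x \in nbhd e X.
    by move=> xX; rewrite inE; apply/existsP; exists x; rewrite xX e1.
  exists (fun x => if x \in X then f1 x else f2 x); split=> [x y xX0 yX0|x xX0].
    have [xX|xX] := boolP (x \in X); have [yX|yX] := boolP (y \in X).
    - exact: inj1.
    - move=> E; have := f2X y; rewrite -E f1X // inE yX yX0 => /(_ isT) //.
    - move=> E; have := f2X x; rewrite E f1X // inE xX xX0 => /(_ isT) //.
    - by apply: inj2; rewrite inE ?xX ?yX.
  have [xX|xX] := boolP (x \in X); first exact: e1.
  by have := e2 x; rewrite inE xX xX0 => /(_ isT) /andP[].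
have /set0Pn[b] : nbhd e [set a] != set0.
  by rewrite -card_gt0 (leq_trans _ (hall [set a] _)) ?cards1 ?sub1set.
rewrite inE => /existsP[a' /andP[/set1P-> eab]].
pose e' x y := e x y && (y != b).
have [f [injf ef]] : exists f : T -> T,
    {in X0 :\ a &, injective f} /\ {in X0 :\ a, forall x, e' x (f x)}.
  apply: (IH e') => [|Y sY]; first by move: leN; rewrite (cardsD1 a X0) aX0; lia.
  have [->|nzY] := eqVneq Y set0; first by rewrite cards0.
  have ltY : #|Y| < #|nbhd e Y|.
    have propY : Y \proper X0.
      by apply: (sub_proper_trans sY); rewrite properD1.
    by move/existsPn/(_ Y): loose; rewrite propY nzY -ltnNge.
  have : nbhd e Y :\ b \subset nbhd e' Y.
    apply/subsetP=> y; rewrite !inE => /andP[yb /existsP[x /andP[xY exy]]].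
    by apply/existsP; exists x; rewrite xY /e' exy.
  move/subset_leq_card; have := cardsD1 b (nbhd e Y); lia.
exists (fun x => if x == a then b else f x); split=> [x y xX0 yX0|x xX0].
  have [->|xa] := eqVneq x a; have [->|ya] := eqVneq y a => //.
  - move=> E; have := ef y; rewrite !inE ya yX0 => /(_ isT) /andP[_].
    by rewrite -E eqxx.
  - move=> E; have := ef x; rewrite !inE xa xX0 => /(_ isT) /andP[_].
    by rewrite -E eqxx.
  - by apply: injf; rewrite !inE ?xa ?ya.
have [->//|xa] := eqVneq x a.
by have := ef x; rewrite !inE xa xX0 => /(_ isT) /andP[].
Qed.

Lemma hall (e : rel T) :
  (forall X : {set T}, #|X| <= #|nbhd e X|) ->
  exists2 f : T -> T, injective f & forall x, e x (f x).
Proof.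
move=> h; have [|f [injf ef]] := @hall_on e setT; first by move=> X _; apply: h.
by exists f => [x y|x]; [apply: injf | apply: ef]; rewrite inE.
Qed.

End Hall.

(** * Ryser's theorem *)

Section PartialLatin.
Variables (T : finType) (n : nat).
Hypothesis cT : #|T| = n.
Implicit Types (L : T -> T -> T) (P Q : T -> T -> option T) (A B : {set T}).

Definition latin L :=
  (forall i, injective (L i)) /\ (forall j, injective (L^~ j)).

Definition platin P :=
  (forall i j1 j2 s, P i j1 = Some s -> P i j2 = Some s -> j1 = j2) /\
  (forall j i1 i2 s, P i1 j = Some s -> P i2 j = Some s -> i1 = i2).

Definition extends Q P := forall i j s, P i j = Some s -> Q i j = Some s.

Definition has_completion P :=
  exists2 L, latin L & forall i j s, P i j = Some s -> L i j = s.

Definition filled_on A B P :=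
  forall i j, (P i j != None) = (i \in A) && (j \in B).

Definition occ P (s : T) := #|[set x : T * T | P x.1 x.2 == Some s]|.

Lemma has_completion_extends P Q :
  extends Q P -> has_completion Q -> has_completion P.
Proof. by move=> ext [L lL LQ]; exists L => // i j s /ext /LQ. Qed.

Lemma filledP (P : T -> T -> option T) i j : P i j != None -> exists s, P i j = Some s.
Proof. by case: (P i j) => // s _; exists s. Qed.

Lemma card_row_symbols P A B i : platin P -> filled_on A B P -> i \in A ->
  #|[set s | [exists j, P i j == Some s]]| = #|B|.
Proof.
move=> [rP _] fP iA.
have <- : #|[set odflt i (P i j) | j in B]| = #|B|.
  apply: card_in_imset => j1 j2 j1B j2B.
  have /filledP[s1 E1] : P i j1 != None by rewrite fP iA.
  have /filledP[s2 E2] : P i j2 != None by rewrite fP iA.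
  by rewrite E1 E2 /= => E; apply: (rP i j1 j2 s1 E1); rewrite E2 E.
apply: eq_card => s; rewrite inE; apply/existsP/imsetP => [[j /eqP E]|[j jB ->]].
  by exists j; rewrite ?E //; have := fP i j; rewrite E iA /= => <-.
have /filledP[s' E] : P i j != None by rewrite fP iA.
by exists j; rewrite E.
Qed.

Lemma card_symbol_rows P A B s : platin P -> filled_on A B P ->
  #|[set i in A | [exists j, P i j == Some s]]| = occ P s.
Proof.
move=> [rP cP] fP; rewrite /occ.
have <- : #|[set x.1 | x in [set x : T * T | P x.1 x.2 == Some s]]| =
    #|[set x : T * T | P x.1 x.2 == Some s]|.
  apply: card_in_imset => [[i1 j1] [i2 j2]]; rewrite !inE /= => /eqP E1 /eqP E2 E.
  by move: E2; rewrite -E => /(rP _ _ _ _ E1) ->.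
apply: eq_card => i; rewrite !inE; apply/andP/imsetP.
  by move=> [_ /existsP[j Pij]]; exists (i, j); rewrite ?inE.
move=> [[i' j]]; rewrite inE /= => Pij ->; split; last by apply/existsP; exists j.
by have := fP i' j; rewrite (eqP Pij) /= => /esym/andP[].
Qed.

Lemma sum_nat_card_swap (T1 T2 : finType) (X : {set T1}) (Y : {set T2})
    (e : T1 -> T2 -> bool) :
  \sum_(x in X) #|[set y in Y | e x y]| = \sum_(y in Y) #|[set x in X | e x y]|.
Proof.
have cardE (U : finType) (Z : {set U}) (p : pred U) :
    #|[set z in Z | p z]| = \sum_(z in Z) (p z : nat).
  rewrite -sum1_card (eq_bigl (fun z => (z \in Z) && p z)); last by move=> z; rewrite inE.
  by rewrite big_mkcondr; apply: eq_bigr => z _; case: (p z).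
under eq_bigr do rewrite cardE.
rewrite exchange_big /=; under [RHS]eq_bigr do rewrite cardE.
by [].
Qed.

(** One application of Hall's theorem chooses the whole new column. Rows outside A are dummies that
    accept every symbol except the tight ones, those with as few occurrences as the condition
    allows. So each tight symbol goes to a row of A and the condition survives the growth of B. *)
Lemma add_column P A B c : platin P -> filled_on A B P -> c \notin B ->
  (forall s : T, #|A| + #|B| <= occ P s + n) ->
  exists Q, [/\ platin Q, extends Q P, filled_on A (c |: B) Q &
    forall s : T, #|A| + #|c |: B| <= occ Q s + n].
Proof.
move=> plP fP cB occP.
pose used (i s : T) := [exists j, P i j == Some s].
pose tight (s : T) := occ P s + n == #|A| + #|B|.
pose e (i s : T) := if i \in A then ~~ used i s else ~~ tight s.
have ltB : #|B| < n.
  by rewrite -cT -cardsT proper_card // properT; apply: contraNneq cB => ->.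
have free_row i : i \in A -> #|[set s | ~~ used i s]| = n - #|B|.
  move=> iA; rewrite -(card_row_symbols plP fP iA).
  rewrite -cT -cardsT -(cardsID [set s | used i s] setT) setTI setTD addKn.
  by apply: eq_card => s; rewrite !inE.
have free_sym s : #|[set i in A | ~~ used i s]| = #|A| - occ P s.
  rewrite -(card_symbol_rows s plP fP).
  rewrite -[in RHS](cardsID [set i in A | used i s] A) (setIidPr _); last first.
    by apply/subsetP=> i; rewrite inE => /andP[].
  rewrite addKn; apply: eq_card => i; rewrite !inE.
  by case: (i \in A); rewrite ?andbF ?andbT.
have occ_le s : occ P s <= #|A|.
  rewrite -(card_symbol_rows s plP fP); apply: subset_leq_card.
  by apply/subsetP=> i; rewrite inE => /andP[].
have [X|f injf ef] := @hall T e.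
  pose X1 := X :&: A; pose N := nbhd e X.
  (* If X lies in A, the edges are counted twice: a row of A misses exactly n - #|B| symbols, and a
     symbol is missing from at most that many rows of A. *)
  have [X2|/set0Pn[i0 /setDP[i0X i0A]]] := eqVneq (X :\: A) set0.
    have XA : X \subset A by rewrite -setD_eq0 X2.
    have : \sum_(i in X) (n - #|B|) <= \sum_(s in N) (n - #|B|).
      apply: (@leq_trans (\sum_(i in X) #|[set s in N | ~~ used i s]|)).
        apply: leq_sum => i iX; have iA := subsetP XA i iX.
        rewrite -(free_row i iA); apply: subset_leq_card.
        apply/subsetP=> s; rewrite !inE => us; rewrite us andbT.
        by apply/existsP; exists i; rewrite iX /e iA.
      rewrite sum_nat_card_swap; apply: leq_sum => s _.
      apply: (@leq_trans (#|A| - occ P s)); last by have := occP s; lia.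
      rewrite -free_sym; apply: subset_leq_card; apply/subsetP=> i.
      by rewrite !inE => /andP[/(subsetP XA) -> ->].
    by rewrite !sum_nat_const leq_pmul2r ?subn_gt0.
  have cardX : #|X| <= #|X :&: A| + (n - #|A|).
    rewrite -(cardsID A X) leq_add2l -[n - _](_ : #|~: A| = _).
      by apply: subset_leq_card; apply/subsetP=> i; rewrite !inE => /andP[].
    by have := cardsC A; rewrite cT; lia.
  (* A symbol not adjacent to the dummy row i0 is tight, hence missing from exactly n - #|B| rows of
     A, none of them in X. Counting these pairs bounds the complement of N by [A :\: X]. *)
  have : \sum_(s in ~: N) (n - #|B|) <= \sum_(i in A :\: X) (n - #|B|).
    apply: (@leq_trans (\sum_(s in ~: N) #|[set i in A :\: X | ~~ used i s]|)).
      apply: leq_sum => s; rewrite !inE => /existsPn sN.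
      have := sN i0; rewrite i0X /e (negPf i0A) /= negbK => /eqP ts.
      have -> : n - #|B| = #|A| - occ P s by have := occ_le s; lia.
      rewrite -free_sym; apply: subset_leq_card; apply/subsetP=> i.
      rewrite !inE => /andP[iA us]; rewrite iA us !andbT.
      by have := sN i; rewrite /e iA us andbT.
    rewrite -sum_nat_card_swap; apply: leq_sum => i; rewrite inE => /andP[_ iA].
    rewrite -(free_row i iA); apply: subset_leq_card.
    by apply/subsetP=> s; rewrite !inE => /andP[].
  rewrite !sum_nat_const leq_pmul2r ?subn_gt0 //.
  have := cardsC N; have := cardsID X A; rewrite setIC cT.
  have : #|A| <= n by rewrite -cT max_card.
  rewrite -/N; lia.
have [g fg gf] := injF_bij injf.
pose Q (i j : T) := if (j == c) && (i \in A) then Some (f i) else P i j.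
have Pc i : P i c = None.
  by apply/eqP; rewrite -[_ == _]negbK fP (negPf cB) andbF.
have QP : extends Q P.
  by move=> i j s E; rewrite /Q; case: eqP => //= jc; move: E; rewrite jc Pc.
have ff i : i \in A -> forall j, P i j != Some (f i).
  by move=> iA j; have := ef i; rewrite /e iA => /existsPn /(_ j).
exists Q; split=> //.
- split=> [i j1 j2 s|j i1 i2 s]; rewrite /Q.
    have [->|_] := eqVneq j1 c; have [->|_] := eqVneq j2 c => //=.
    + have [iA|_] := boolP (i \in A); last by rewrite Pc.
      by move=> [<-] E; have := ff i iA j2; rewrite E eqxx.
    + have [iA|_] := boolP (i \in A); last by rewrite Pc.
      by move=> E [E2]; have := ff i iA j1; rewrite E E2 eqxx.
    + exact: plP.1.
  have [->|_] := eqVneq j c => /=; last exact: plP.2.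
  rewrite !Pc; case: ifP => // _ [<-]; case: ifP => // _ [E].
  exact: injf.
- move=> i j; rewrite /Q !inE; have [->|_] := eqVneq j c => /=; last exact: fP.
  by rewrite Pc; case: ifP.
move=> s; rewrite cardsU1 cB /=.
have occS : occ P s <= occ Q s.
  apply: subset_leq_card; apply/subsetP=> x; rewrite !inE => /eqP E.
  by rewrite (QP _ _ _ E).
have [ts|nts] := boolP (tight s); last by have := occP s; move: nts; rewrite /tight; lia.
have gA : g s \in A.
  by have := ef (g s); rewrite /e gf ts /=; case: (g s \in A).
suff : occ P s < occ Q s by move: ts; rewrite /tight; lia.
apply: proper_card; apply/properP; split.
  by apply/subsetP=> x; rewrite !inE => /eqP E; rewrite (QP _ _ _ E).
by exists (g s, c); rewrite !inE /= ?Pc // /Q eqxx gA /= gf.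
Qed.

Lemma add_columns P A B : platin P -> filled_on A B P ->
  (forall s : T, #|A| + #|B| <= occ P s + n) ->
  exists Q, [/\ platin Q, extends Q P & filled_on A setT Q].
Proof.
move: {2}#|~: B| (erefl #|~: B|) => m; elim: m P B => [|m IH] P B cB plP fP oP.
  exists P; split=> //; have /eqP := cB; rewrite cards_eq0 => /eqP BT.
  by have <- : B = setT; [rewrite -[B]setCK BT setC0 | ].
have /set0Pn[c] : ~: B != set0 by rewrite -card_gt0 cB.
rewrite inE => cnB.
have [Q [plQ QP fQ oQ]] := add_column plP fP cnB oP.
have [|R [plR RQ fR]] := IH Q (c |: B) _ plQ fQ oQ.
  have := cardsC (c |: B); have := cardsC B; rewrite cardsU1 cnB !cT; lia.
by exists R; split=> // i j s /QP /RQ.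
Qed.

Lemma filled_completion P : platin P -> (forall i j, P i j != None) ->
  has_completion P.
Proof.
move=> [rP cP] fP; exists (fun i j => odflt i (P i j)); last by move=> i j s ->.
split=> [i j1 j2|j i1 i2] /=.
  have /filledP[s1 E1] := fP i j1; have /filledP[s2 E2] := fP i j2.
  by rewrite E1 E2 /= => E; apply: (rP i _ _ s1) => //; rewrite E2 E.
have /filledP[s1 E1] := fP i1 j; have /filledP[s2 E2] := fP i2 j.
by rewrite E1 E2 /= => E; apply: (cP j _ _ s1) => //; rewrite E2 E.
Qed.

Let swapK : involutive (fun x : T * T => (x.2, x.1)).
Proof. by case. Qed.

(** Once the rows of A are full, every symbol occurs in each of them, so the transposed array
    satisfies the same condition and its missing columns can be added too. *)
Theorem ryser P A B : platin P -> filled_on A B P ->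
  (forall s : T, #|A| + #|B| <= occ P s + n) -> has_completion P.
Proof.
move=> plP fP oP.
have [Q [plQ QP fQ]] := add_columns plP fP oP.
apply: (has_completion_extends QP).
pose Qt (i j : T) := Q j i.
have plQt : platin Qt by split; [exact: plQ.2 | exact: plQ.1].
have fQt : filled_on setT A Qt by move=> i j; rewrite /Qt fQ !inE andbT.
have [|R [plR RQ fR]] := add_columns plQt fQt.
  move=> s; rewrite cardsT cT addnC leq_add2r.
  rewrite -(_ : #|[set i in A | [exists j, Q i j == Some s]]| = #|A|).
    rewrite (card_symbol_rows s plQ fQ) /occ.
    rewrite -(card_imset [set x : T * T | Q x.1 x.2 == Some s] (inv_inj swapK)) //.
    apply: subset_leq_card; apply/subsetP=> x /imsetP[[i j]]; rewrite !inE /= => E ->.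
    exact: E.
  apply: eq_card => i; rewrite inE; have [iA|//] := boolP (i \in A).
  apply/existsP; have := card_row_symbols plQ fQ iA; rewrite cardsT.
  move/eqP; rewrite -cardsT => /eqP E.
  have : [set s0 | [exists j, Q i j == Some s0]] == setT.
    by rewrite eqEcard subsetT E leqnn.
  by move=> /eqP/setP/(_ s); rewrite !inE => /existsP.
have [L lL LR] : has_completion R.
  by apply: (filled_completion plR) => i j; rewrite fR !inE.
exists (fun i j => L j i); first by split; [exact: lL.2 | exact: lL.1].
by move=> i j s E; apply/LR/RQ.
Qed.

(** A blank cell of the rectangle sees at most (#|A| - 1) + (#|B| - 1) < n symbols, so a greedy
    choice never gets stuck. *)
Lemma fill_rectangle P A B : platin P ->
  (forall i j, P i j != None -> (i \in A) && (j \in B)) -> #|A| + #|B| <= n ->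
  exists Q, [/\ platin Q, extends Q P & filled_on A B Q].
Proof.
move=> plP PAB leAB.
pose blank P := [set x in setX A B | P x.1 x.2 == None].
move: {2}#|blank P| (erefl #|blank P|) => m; elim: m P plP PAB => [|m IH] P plP PAB bP.
  exists P; split=> // i j; apply/idP/idP => [/PAB //|ijAB].
  apply/negP=> Pij; have /eqP := bP; rewrite cards_eq0 => /eqP/setP/(_ (i, j)).
  by rewrite !inE /= ijAB Pij.
have /set0Pn[[i j]] : blank P != set0 by rewrite -card_gt0 bP.
rewrite !inE /= => /andP[/andP[iA jB] /eqP Pij].
(* Blank cells contribute the dummy symbol i. This may forbid i needlessly, but only the sizes of U1
   and U2 matter. *)
pose U1 := [set odflt i (P i j') | j' in B :\ j].
pose U2 := [set odflt i (P i' j) | i' in A :\ i].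
have [U12|/properP[_ [s _]]] : U1 :|: U2 = setT \/ U1 :|: U2 \proper setT.
- by have [->|ne] := eqVneq (U1 :|: U2) setT; [left | right; rewrite properEneq ne subsetT].
- have leU1 : #|U1| <= #|B :\ j| by exact: leq_imset_card.
  have leU2 : #|U2| <= #|A :\ i| by exact: leq_imset_card.
  have := leq_card_setU U1 U2; rewrite U12 cardsT cT => -[leU _].
  have := cardsD1 j B; have := cardsD1 i A; rewrite iA jB; lia.
rewrite inE negb_or => /andP[sU1 sU2].
have s1 j' : P i j' <> Some s.
  move=> E; case/imsetP: sU1; exists j'; last by rewrite E.
  rewrite !inE; have : P i j' != None by rewrite E.
  move/PAB => /andP[_ j'B]; rewrite j'B andbT.
  by apply/eqP=> jj; rewrite jj Pij in E.
have s2 i' : P i' j <> Some s.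
  move=> E; case/imsetP: sU2; exists i'; last by rewrite E.
  have : P i' j != None by rewrite E.
  move/PAB => /andP[i'A _]; rewrite !inE i'A andbT.
  by apply/eqP=> ii; rewrite ii Pij in E.
pose Q (i0 j0 : T) := if (i0 == i) && (j0 == j) then Some s else P i0 j0.
have QP : extends Q P.
  move=> i0 j0 t E; rewrite /Q; case: andP => // -[/eqP ii /eqP jj].
  by rewrite ii jj Pij in E.
have [|||R [plR RQ fR]] := IH Q.
- split=> [i0 j1 j2 t|j0 i1 i2 t]; rewrite /Q.
    have [->|_] := eqVneq i0 i => /=; last exact: plP.1.
    case: eqP => [->|_]; case: eqP => [->|_] //.
    + by move=> [<-] /s1.
    + by move=> E [E2]; rewrite -E2 in E; case: (s1 _ E).
    + exact: plP.1.
  have [->|_] := eqVneq j0 j; rewrite ?andbT ?andbF; last exact: plP.2.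
  case: eqP => [->|_]; case: eqP => [->|_] //.
  + by move=> [<-] /s2.
  + by move=> E [E2]; rewrite -E2 in E; case: (s2 _ E).
  + exact: plP.2.
- move=> i0 j0; rewrite /Q; case: andP => [[/eqP-> /eqP->]|_]; last exact: PAB.
  by rewrite iA jB.
- suff : blank Q = blank P :\ (i, j).
    by move->; have := cardsD1 (i, j) (blank P); rewrite !inE /= iA jB Pij eqxx /= bP; lia.
  apply/setP=> -[i0 j0]; rewrite !inE /= /Q xpair_eqE.
  by case: (_ && (j0 == j)); rewrite ?andbF.
by exists R; split=> // i0 j0 t /QP /RQ.
Qed.

(** The rows and columns that meet filled cells number at most n together, so Ryser's condition
    holds however rarely a symbol occurs. *)
Lemma few_filled_completion P : platin P ->
  2 * #|[set x : T * T | P x.1 x.2 != None]| <= n -> has_completion P.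
Proof.
set F := [set x | _] => plP leF.
have leF1 : #|[set x.1 | x in F]| <= #|F| by exact: leq_imset_card.
have leF2 : #|[set x.2 | x in F]| <= #|F| by exact: leq_imset_card.
have [||Q [plQ QP fQ]] := @fill_rectangle P [set x.1 | x in F] [set x.2 | x in F] plP.
- by move=> i j Pij; apply/andP; split; apply/imsetP; exists (i, j); rewrite ?inE.
- lia.
by apply: (has_completion_extends QP); apply: (ryser plQ fQ) => s; lia.
Qed.

End PartialLatin.

(** * Trades *)

Section Trades.
Variable T : finType.
Implicit Types (L : T -> T -> T) (Tr F : {set T * T}).

(** Column of s in row i; [rw] is likewise the row of s in column j. In a Latin square the defaults
    are never reached. *)
Definition cl L i s := odflt i [pick j | L i j == s].
Definition rw L j s := odflt j [pick i | L i j == s].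

Lemma clK L i s : latin L -> L i (cl L i s) = s.
Proof.
move=> [rL _]; rewrite /cl; case: pickP => [j /eqP //|/= none].
have [g _ gK] := injF_bij (rL i).
by have := none (g s); rewrite gK eqxx.
Qed.

Lemma rwK L j s : latin L -> L (rw L j s) j = s.
Proof.
move=> [_ cL]; rewrite /rw; case: pickP => [i /eqP //|/= none].
have [g _ gK] := injF_bij (cL j).
by have := none (g s); rewrite gK eqxx.
Qed.

Lemma clE L i j : latin L -> cl L i (L i j) = j.
Proof. by move=> lL; apply: (lL.1 i); rewrite clK. Qed.

Lemma rwE L i j : latin L -> rw L j (L i j) = i.
Proof. by move=> lL; apply: (lL.2 j); rewrite /= rwK. Qed.

(** [Tr] is only an upper bound for the set of changed cells. *)
Definition trade L Tr L' :=
  latin L' /\ forall i j, (i, j) \notin Tr -> L' i j = L i j.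

Lemma trade_trans L L1 L2 Tr1 Tr2 :
  trade L Tr1 L1 -> trade L1 Tr2 L2 -> trade L (Tr1 :|: Tr2) L2.
Proof.
move=> [_ E1] [l2 E2]; split=> // i j; rewrite inE negb_or => /andP[n1 n2].
by rewrite E2 ?E1.
Qed.

Lemma trade_sub L L' Tr Tr' : trade L Tr L' -> Tr \subset Tr' -> trade L Tr' L'.
Proof.
move=> [l' E] /subsetP sub; split=> // i j nij; apply: E.
by apply: contra nij => /sub.
Qed.

(** Were the old place of the new symbol outside [Tr], that cell would keep it and row i of L' would
    contain it twice. *)
Lemma trade_row L L' Tr i j : latin L -> trade L Tr L' -> (i, j) \in Tr ->
  exists2 j', (i, j') \in Tr & L i j' = L' i j.
Proof.
move=> lL [lL' E] ijT; exists (cl L i (L' i j)); last by rewrite clK.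
apply: contraLR ijT => nT; have := E _ _ nT; rewrite clK // => /lL'.1 <-.
exact: nT.
Qed.

Lemma trade_col L L' Tr i j : latin L -> trade L Tr L' -> (i, j) \in Tr ->
  exists2 i', (i', j) \in Tr & L i' j = L' i j.
Proof.
move=> lL [lL' E] ijT; exists (rw L j (L' i j)); last by rewrite rwK.
apply: contraLR ijT => nT; have := E _ _ nT; rewrite rwK // => /lL'.2 <-.
exact: nT.
Qed.

(** Suppose a cell of [Tr2] clashes with a cell outside it in the same line. By [trade_row] and
    [trade_col], the common symbol then stood in L twice on that line, once inside [Tr2] and once
    outside. *)
Lemma trade_par L L1 L2 Tr1 Tr2 : latin L ->
  trade L Tr1 L1 -> trade L Tr2 L2 -> [disjoint Tr1 & Tr2] ->
  exists L', [/\ trade L (Tr1 :|: Tr2) L',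
    forall i j, (i, j) \notin Tr2 -> L' i j = L1 i j &
    forall i j, (i, j) \notin Tr1 -> L' i j = L2 i j].
Proof.
move=> lL t1 t2 dis.
have dis12 x : x \in Tr1 -> x \in Tr2 -> False.
  by move=> x1 x2; have := disjointFr dis x1; rewrite x2.
pose L' i j := if (i, j) \in Tr2 then L2 i j else L1 i j.
have [l1 E1] := t1; have [l2 E2] := t2.
exists L'; split=> [|i j nij|i j nij]; rewrite /L'.
- split; first split=> [i j1 j2|j i1 i2] /=; last first.
  + move=> i j; rewrite inE negb_or => /andP[n1 n2].
    by rewrite (negPf n2) E1.
  + have aux i i' : (i, j) \in Tr2 -> (i', j) \notin Tr2 -> L2 i j = L1 i' j -> i = i'.
      move=> iT nT E; have [i0 i0T E0] := trade_col lL t2 iT.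
      have [i'T|i'nT] := boolP ((i', j) \in Tr1).
        have [i3 i3T E3] := trade_col lL t1 i'T.
        have := lL.2 j i0 i3; rewrite /= E0 E3 => /(_ E) i03.
        by case: (dis12 (i3, j)) => //; rewrite -i03.
      rewrite E1 // -E0 in E; have := lL.2 _ _ _ E => i0i'.
      by rewrite -i0i' i0T in nT.
    case: ifPn => h1; case: ifPn => h2; try exact: l2.2; try exact: l1.2.
      exact: aux.
    by move=> E; apply/esym/aux.
  + have aux j j' : (i, j) \in Tr2 -> (i, j') \notin Tr2 -> L2 i j = L1 i j' -> j = j'.
      move=> iT nT E; have [i0 i0T E0] := trade_row lL t2 iT.
      have [i'T|i'nT] := boolP ((i, j') \in Tr1).
        have [i3 i3T E3] := trade_row lL t1 i'T.
        have := lL.1 i i0 i3; rewrite /= E0 E3 => /(_ E) i03.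
        by case: (dis12 (i, i3)) => //; rewrite -i03.
      rewrite E1 // -E0 in E; have := lL.1 _ _ _ E => i0i'.
      by rewrite -i0i' i0T in nT.
    case: ifPn => h1; case: ifPn => h2; try exact: l2.1; try exact: l1.1.
      exact: aux.
    by move=> E; apply/esym/aux.
- by rewrite (negPf nij).
- by case: ifP => // h; rewrite E1 // E2 // h.
Qed.

Lemma switch L r1 r2 c1 c2 : latin L -> r1 != r2 ->
  L r1 c1 = L r2 c2 -> L r1 c2 = L r2 c1 ->
  exists L', [/\ trade L [set (r1, c1); (r1, c2); (r2, c1); (r2, c2)] L',
    L' r1 c1 = L r1 c2 /\ L' r1 c2 = L r1 c1 &
    L' r2 c1 = L r1 c1 /\ L' r2 c2 = L r1 c2].
Proof.
move=> lL r12 Ea Eb; pose C := [set c1; c2].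
(* Exchanging two rows inside two columns keeps columns Latin at once; in each of the two rows it
   merely swaps two symbols. *)
pose L' i j := if j \in C then L (tperm r1 r2 i) j else L i j.
have C1 : c1 \in C by rewrite !inE eqxx.
have C2 : c2 \in C by rewrite !inE eqxx orbT.
exists L'; split; last 2 first.
- by rewrite /L' C1 C2 tpermL.
- by rewrite /L' C1 C2 tpermR.
split; last first.
  move=> i j; rewrite !inE !xpair_eqE /L' /C !inE.
  have [_|_] := eqVneq j c1; have [_|_] := eqVneq j c2 => //=;
  rewrite ?andbT ?andbF ?orbF /= => H; rewrite tpermD //; apply: contraNneq H => ->; by rewrite eqxx ?orbT.
split=> [i j1 j2|j i1 i2]; rewrite /L' /=; last first.
  case: ifP => _; last exact: lL.2.
  by move/(lL.2 j)/perm_inj.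
have aux j j' : j \in C -> j' \notin C -> L (tperm r1 r2 i) j = L i j' -> j = j'.
  move=> jC j'C E; suff [k kC Ek] : exists2 k, k \in C & L (tperm r1 r2 i) j = L i k.
    by rewrite Ek in E; move: (lL.1 _ _ _ E) j'C => <-; rewrite kC.
  case: tpermP => [->|->|_ _]; [| |by exists j].
    by move: jC; rewrite !inE => /orP[] /eqP->; [exists c2 | exists c1] => //; rewrite !inE eqxx ?orbT.
  by move: jC; rewrite !inE => /orP[] /eqP->; [exists c2 | exists c1] => //; rewrite !inE eqxx ?orbT.
case: ifPn => h1; case: ifPn => h2; try exact: lL.1.
  exact: aux.
by move=> E; apply/esym/aux.
Qed.

End Trades.

(** * The dihedral table *)

Import GRing.Theory.

Section Dihedral.
Variable Z : finComNzRingType.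
Local Open Scope ring_scope.
Implicit Types u v w x s : bool * Z.

(** The dihedral group with rotations r^x and reflection t, relabelled: a row (true, x) stands for
    r^x t, a column or symbol (true, y) for r^(-y) t, and (false, x) always for r^x. *)
Definition dop u v : bool * Z :=
  (u.1 (+) v.1, if u.1 (+) v.1 then v.2 - u.2 else v.2 + u.2).
Definition ldiv x s : bool * Z :=
  (x.1 (+) s.1, if s.1 then s.2 + x.2 else s.2 - x.2).
Definition rdiv v s : bool * Z :=
  (v.1 (+) s.1, if s.1 then v.2 - s.2 else s.2 - v.2).

Lemma dop_ldiv x s : dop x (ldiv x s) = s.
Proof.
by case: x s => [[] x] [[] s]; rewrite /dop /ldiv /=; congr (_, _); ring.
Qed.

Lemma dop_rdiv v s : dop (rdiv v s) v = s.
Proof.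
by case: v s => [[] x] [[] s]; rewrite /dop /rdiv /=; congr (_, _); ring.
Qed.

Lemma dopIl v : injective (dop^~ v).
Proof.
move=> [a x] [b y]; case: v => c z; rewrite /dop /= => -[/addIb ->].
by case: ifP => _ /addrI => [/oppr_inj|] ->.
Qed.

Lemma dopIr u : injective (dop u).
Proof.
move=> [a x] [b y]; case: u => c z; rewrite /dop /= => -[/addbI ->].
by case: ifP => _ /addIr ->.
Qed.

Lemma ldivI s : injective (ldiv^~ s).
Proof. by move=> x y /= E; apply: (@dopIl (ldiv y s)); rewrite /= -{1}E !dop_ldiv. Qed.

Lemma rdivI s : injective (rdiv^~ s).
Proof. by move=> x y /= E; apply: (@dopIr (rdiv y s)); rewrite -{1}E !dop_rdiv. Qed.

(* Elements of odd type are involutions, so each cell lies in one intercalate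
   with every line of the opposite type. *)
Lemma intercalate_row x r c : x.1 != r.1 ->
  dop r (ldiv x (dop r c)) = dop x c.
Proof.
by case: x r c => [[] x] [[] r] [[] c] // _; rewrite /dop /ldiv /=; congr (_, _); ring.
Qed.

(** By [rdiv_type] the row [rdiv z s] has the type opposite to r, so this is the intercalate of
    these two rows through the s of row r. *)
Lemma intercalate_col x r c s : x.1 != (rdiv c s).1 ->
  let z := ldiv x (dop r c) in
  dop (rdiv z s) (ldiv r s) = dop r z.
Proof.
by case: x r c s => [[] x] [[] r] [[] c] [[] s] //= _; rewrite /dop /ldiv /rdiv /=; congr (_, _); ring.
Qed.

Lemma rdiv_type x r c s : x.1 != (rdiv c s).1 ->
  (rdiv (ldiv x (dop r c)) s).1 != r.1.
Proof. by case: x r c s => [[] x] [[] r] [[] c] [[] s]. Qed.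

End Dihedral.

Ltac notin_cells := apply/negP; rewrite ?inE ?xpair_eqE -?orbA;
  repeat case/orP; by case/andP=> /eqP ? /eqP ?; congruence.

Ltac disjoint_cells := rewrite disjoint_subset; apply/subsetP => ?;
  rewrite !inE -?orbA; repeat case/orP; move/eqP->; notin_cells.

(** * Light moves: putting a symbol into a cell where few cells are disturbed *)

Section Loads.
Variable T : finType.
Implicit Types D F : {set T * T}.

Definition rload D i := #|[set j | (i, j) \in D]|.
Definition cload D j := #|[set i | (i, j) \in D]|.

End Loads.

Lemma card_preim_le (T1 T2 : finType) (H : {set T1}) (Y : {set T2}) (f : T1 -> T2) :
  {in H &, injective f} -> #|[set x in H | f x \in Y]| <= #|Y|.
Proof.
move=> injf; rewrite -(@card_in_imset _ _ f); last first.
  by move=> x y; rewrite !inE => /andP[xH _] /andP[yH _]; apply: injf.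
by apply: subset_leq_card; apply/subsetP=> y /imsetP[x]; rewrite inE => /andP[_ ?] ->.
Qed.

Section LightPut.
Variables (T : finType) (Z : finComNzRingType) (iota : bool * Z -> T).
Hypothesis iotaI : injective iota.
Implicit Types (L : T -> T -> T) (D : {set T * T}).

(** Symbols are read from the dihedral table and not from the current square, so the load depends on
    D only. *)
Definition sload D s :=
  #|[set p : (bool * Z) * (bool * Z) |
      ((iota p.1, iota p.2) \in D) && (iota (dop p.1 p.2) == s)]|.

(** In particular D contains every cell whose row or column is outside the range of [iota]. *)
Definition dihedral_off D L := forall i j, (i, j) \notin D ->
  exists u v, [/\ i = iota u, j = iota v & L i j = iota (dop u v)].

Lemma dihedral_offE D L u v : dihedral_off D L -> (iota u, iota v) \notin D ->
  L (iota u) (iota v) = iota (dop u v).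
Proof. by move=> dL /dL[u' [v' [/iotaI-> /iotaI-> ->]]]. Qed.

(* A row x in the half opposite to the row R' of S in column C determines the
   column z with L x z = L R C; S is moved to row x in column C and to column z
   in row R by two disjoint intercalates. The hypothesis on the loads leaves
   some x for which all cells involved are outside D. *)
Lemma light_put D L R C S : latin L -> dihedral_off D L ->
  (R, C) \notin D -> (R, cl L R S) \notin D -> (rw L C S, C) \notin D ->
  cload D C + rload D (rw L C S) + 2 * sload D S + sload D (L R C) +
    rload D R + cload D (cl L R S) + 1 < #|Z| ->
  exists Tr L', [/\ trade L Tr L', [disjoint Tr & D], #|Tr| <= 10 & L' R C = S].
Proof.
move=> lL dL nRC nRC' nR'C.
have [ES|neS] := eqVneq (L R C) S.
  move=> _; exists set0, L; split=> //; first by rewrite -setI_eq0 set0I.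
  by rewrite cards0.
set C' := cl L R S in nRC' *; set R' := rw L C S in nR'C *.
have LRC' : L R C' = S by exact: clK.
have LR'C : L R' C = S by exact: rwK.
have [r [c [ER EC ERC]]] := dL _ _ nRC.
have [r1 [c' [ER1 EC' ERC']]] := dL _ _ nRC'.
have [r' [c1 [ER' EC1 ER'C]]] := dL _ _ nR'C.
have Er1 : r1 = r by apply: iotaI; rewrite -ER1.
have Ec1 : c1 = c by apply: iotaI; rewrite -EC1.
subst r1 c1; pose s := dop r c'.
have ES : S = iota s by rewrite -ERC' LRC'.
have Es' : dop r' c = s by apply: iotaI; rewrite -ER'C -ES LR'C.
have Ec' : c' = ldiv r s by apply: (@dopIr _ r); rewrite dop_ldiv.
have Er' : r' = rdiv c s by apply: (@dopIl _ c); rewrite /= dop_rdiv.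
pose a := dop r c; pose z x := ldiv x a; pose d x := ldiv x s; pose e x := rdiv (z x) s.
pose H := [set x : bool * Z | x.1 != r'.1].
have cardH : #|H| = #|Z|.
  have <- : #|[set (~~ r'.1, t) | t in [set: Z]]| = #|Z|.
    by rewrite card_imset ?cardsT // => ? ? [].
  apply: eq_card => -[b t]; rewrite !inE /=; apply/idP/imsetP => [bt|[t' _ [-> _]]].
    by exists t => //; congr (_, _); move: bt; case: b (r'.1) => [] [].
  by case: (r'.1).
move=> lt_loads.
(* Each of B1 to B7 excludes the x that send one cell of the trade into D. That cell depends
   injectively on x and stays on one row, column or symbol, whose load bounds the set. *)
pose B1 := [set x in H | iota x \in [set i | (i, C) \in D]].
pose B2 := [set x in H | iota (d x) \in [set j | (R', j) \in D]].
pose symD t := [set p : (bool * Z) * (bool * Z) |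
      ((iota p.1, iota p.2) \in D) && (iota (dop p.1 p.2) == t)].
pose B3 := [set x in H | (x, d x) \in symD S].
pose B4 := [set x in H | (x, z x) \in symD (L R C)].
pose B5 := [set x in H | iota (z x) \in [set j | (R, j) \in D]].
pose B6 := [set x in H | (e x, z x) \in symD S].
pose B7 := [set x in H | iota (e x) \in [set i | (i, C') \in D]].
have zI : injective z by exact: ldivI.
have eI : injective e by move=> x y /rdivI /zI.
have b1 : #|B1| <= cload D C by apply: card_preim_le => x y _ _ /iotaI.
have b2 : #|B2| <= rload D R' by apply: card_preim_le => x y _ _ /iotaI /ldivI.
have b3 : #|B3| <= sload D S by apply: card_preim_le => x y _ _ /(congr1 fst).
have b4 : #|B4| <= sload D (L R C) by apply: card_preim_le => x y _ _ /(congr1 fst).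
have b5 : #|B5| <= rload D R by apply: card_preim_le => x y _ _ /iotaI /zI.
have b6 : #|B6| <= sload D S by apply: card_preim_le => x y _ _ /(congr1 fst) /eI.
have b7 : #|B7| <= cload D C' by apply: card_preim_le => x y _ _ /iotaI /eI.
pose Bad := [set r] :|: B1 :|: B2 :|: B3 :|: B4 :|: B5 :|: B6 :|: B7.
have ltBad : #|Bad| < #|H|.
  rewrite cardH; apply: leq_ltn_trans lt_loads; rewrite /Bad.
  rewrite !cardsU cards1; lia.
have /subsetPn[x xH] : ~~ (H \subset Bad).
  by apply: contraL ltBad => /subset_leq_card; rewrite -leqNgt.
have xr' : x.1 != r'.1 by rewrite inE in xH.
rewrite /Bad !in_setU !negb_or inE -!andbA => /and5P[xr n1 n2 n3 /and4P[n4 n5 n6 n7]].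
have opE u v t : iota (dop u v) = t -> (u, v) \notin symD t -> (iota u, iota v) \notin D.
  by move=> E; rewrite inE /= E eqxx andbT.
have {n1} n1 : (iota x, C) \notin D by apply: contra n1 => h; rewrite inE xH inE.
have {n2} n2 : (R', iota (d x)) \notin D by apply: contra n2 => h; rewrite inE xH inE.
have {n3} n3 : (iota x, iota (d x)) \notin D.
  by apply: (opE _ _ S); [rewrite dop_ldiv | apply: contra n3 => h; rewrite inE xH].
have {n4} n4 : (iota x, iota (z x)) \notin D.
  apply: (opE _ _ (L R C)); first by rewrite dop_ldiv ERC.
  by apply: contra n4 => h; rewrite inE xH.
have {n5} n5 : (R, iota (z x)) \notin D by apply: contra n5 => h; rewrite inE xH inE.
have {n6} n6 : (iota (e x), iota (z x)) \notin D.
  by apply: (opE _ _ S); [rewrite dop_rdiv | apply: contra n6 => h; rewrite inE xH].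
have {n7} n7 : (iota (e x), C') \notin D by apply: contra n7 => h; rewrite inE xH inE.
have LXD : L (iota x) (iota (d x)) = S by rewrite (dihedral_offE dL n3) dop_ldiv.
have LXZ : L (iota x) (iota (z x)) = L R C by rewrite (dihedral_offE dL n4) dop_ldiv ERC.
have LEZ : L (iota (e x)) (iota (z x)) = S by rewrite (dihedral_offE dL n6) dop_rdiv.
have LXC : L R' (iota (d x)) = L (iota x) C.
  rewrite ER' EC; rewrite ER' in n2; rewrite EC in n1.
  rewrite (dihedral_offE dL n1) (dihedral_offE dL n2) /d -Es'.
  by rewrite intercalate_row.
have LRZ : L R (iota (z x)) = L (iota (e x)) C'.
  rewrite ER EC'; rewrite ER in n5; rewrite EC' in n7.
  rewrite (dihedral_offE dL n5) (dihedral_offE dL n7) Ec' /e /z /a.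
  by rewrite intercalate_col // -Er'.
have R'X : R' <> iota x by rewrite ER' => /iotaI E; rewrite E eqxx in xr'.
have RE : R <> iota (e x).
  rewrite ER => /iotaI E; have := @rdiv_type _ x r c s.
  by rewrite -Er' xr' => /(_ isT); rewrite -/(z x) -/(e x) -E eqxx.
have XR : iota x <> R by rewrite ER => /iotaI E; rewrite E eqxx in xr.
move: (iota x) (iota (d x)) (iota (z x)) (iota (e x)) R'X RE XR
  LXD LXZ LEZ LXC LRZ n1 n2 n3 n4 n5 n6 n7 => X Dd Zz E R'X RE XR
  LXD LXZ LEZ LXC LRZ n1 n2 n3 n4 n5 n6 n7.
have RR' : R <> R' by move=> h; case/eqP: neS; rewrite h LR'C.
have CC' : C <> C' by move=> h; case/eqP: neS; rewrite h LRC'.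
have XE : X <> E by move=> h; case/eqP: neS; rewrite -LXZ h.
have CZ : C <> Zz by move=> h; apply: XR; apply: (lL.2 C); rewrite /= [in LHS]h.
have DC' : Dd <> C' by move=> h; apply: XR; apply: (lL.2 C'); rewrite /= -[in LHS]h LXD.
have DZ : Dd <> Zz by move=> h; case/eqP: neS; rewrite -LXZ -h.
have [L1 [t1 [_ _] [L1XC _]]] := @switch _ L R' X C Dd lL (introN eqP R'X) (etrans LR'C (esym LXD)) LXC.
have [L2 [t2 [_ L2RZ] _]] := @switch _ L R E C' Zz lL (introN eqP RE) (etrans LRC' (esym LEZ)) LRZ.
have [|L3 [t3 E1 E2]] := trade_par lL t1 t2; first by disjoint_cells.
have L3RC : L3 R C = L R C by apply: t3.2; notin_cells.
have L3XZ : L3 X Zz = L R C by rewrite t3.2 //; notin_cells.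
have L3RZ : L3 R Zz = S by rewrite E2 ?L2RZ //; notin_cells.
have L3XC : L3 X C = S by rewrite E1 ?L1XC //; notin_cells.
(* Rows R, X and columns C, Zz now hold the old symbol of (R, C) on one diagonal and S on the
   other. *)
have [L4 [t4 [L4RC _] _]] := @switch _ L3 R X C Zz t3.1 (introN eqP (nesym XR))
  (etrans L3RC (esym L3XZ)) (etrans L3RZ (esym L3XC)).
pose Tl := [:: (R', C); (R', Dd); (X, C); (X, Dd); (R, C'); (R, Zz); (E, C'); (E, Zz); (R, C); (X, Zz)].
exists [set p in Tl], L4; split.
- apply: (trade_sub (trade_trans t3 t4)); apply/subsetP=> p; rewrite !inE.
  by repeat case/orP; move=> ->; rewrite ?orbT.
- rewrite disjoint_subset; apply/subsetP=> p; rewrite !inE.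
  by repeat case/orP; move/eqP->.
- by rewrite cardsE (leq_trans (card_size _)).
- by rewrite L4RC.
Qed.

End LightPut.

(** * Averaging *)

Section Averaging.
Variables (T : finType) (n : nat).
Hypothesis cT : #|T| = n.
Implicit Types (D : {set T * T}).

Lemma sum_mem_inj (X : {set T * T}) (f : T -> T -> T * T) :
  (forall z1 y1 z2 y2, f z1 y1 = f z2 y2 -> z1 = z2 /\ y1 = y2) ->
  \sum_z \sum_y (f z y \in X : nat) <= #|X|.
Proof.
move=> injf; rewrite pair_big /=.
rewrite (eq_bigr (fun x : T * T => if f x.1 x.2 \in X then 1 else 0)); last first.
  by move=> x _; case: (_ \in X).
rewrite -big_mkcond /= sum1_card.
have leX : #|[set x in [set: T * T] | f x.1 x.2 \in X]| <= #|X|.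
  by apply: card_preim_le => -[z1 y1] [z2 y2] _ _ /= /injf[-> ->].
by apply: leq_trans leX; apply: subset_leq_card; apply/subsetP=> x; rewrite !inE.
Qed.

Lemma sum_const_T (a : nat) : \sum_(z : T) a = n * a.
Proof. by rewrite sum_nat_const cT. Qed.

Lemma sum_load_inj (ld : T -> nat) (h : T -> T) : injective h ->
  \sum_y ld (h y) = \sum_y ld y.
Proof. by move=> injh; rewrite [RHS](reindex h) //; apply/onW_bij/injF_bij. Qed.

Lemma sum_load_row (ld : T -> nat) (h : T -> T -> T) :
  (forall z, injective (h z)) -> \sum_z \sum_y ld (h z y) = n * \sum_y ld y.
Proof.
by move=> injh; rewrite -sum_const_T; apply: eq_bigr => z _; apply: sum_load_inj.
Qed.

Lemma sum_load_col (ld : T -> nat) (h : T -> T -> T) :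
  (forall y, injective (h^~ y)) -> \sum_z \sum_y ld (h z y) = n * \sum_y ld y.
Proof. by move=> injh; rewrite exchange_big /=; apply: sum_load_row. Qed.

Lemma sum_rload D : \sum_i rload D i = #|D|.
Proof.
rewrite -sum1_card (partition_big (fun x => x.1) predT) //=.
apply: eq_bigr => i _; rewrite sum1_card /rload.
have <- : #|[set (i, j) | j in [set j | (i, j) \in D]]| = #|[set j | (i, j) \in D]|.
  by apply: card_imset => ? ? [].
apply: eq_card => -[i' j]; apply/imsetP/idP.
  move=> [j'].
  by rewrite ?inE => h [-> ->]; rewrite unfold_in /= h eqxx.
by rewrite unfold_in /= => /andP[h /eqP <-]; exists j; rewrite ?inE.
Qed.

Lemma sum_cload D : \sum_j cload D j = #|D|.
Proof.
rewrite -sum1_card (partition_big (fun x => x.2) predT) //=.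
apply: eq_bigr => j _; rewrite sum1_card /cload.
have <- : #|[set (i, j) | i in [set i | (i, j) \in D]]| = #|[set i | (i, j) \in D]|.
  by apply: card_imset => ? ? [].
apply: eq_card => -[i j']; apply/imsetP/idP.
  move=> [i'].
  by rewrite ?inE => h [-> ->]; rewrite unfold_in /= h eqxx.
by rewrite unfold_in /= => /andP[h /eqP <-]; exists i; rewrite ?inE.
Qed.

Lemma rloadU D F i : rload (D :|: F) i <= rload D i + #|F|.
Proof.
apply: leq_trans (_ : #|[set j | (i, j) \in D] :|: [set j in setT | (i, j) \in F]| <= _).
  by apply: subset_leq_card; apply/subsetP=> j; rewrite !inE.
have [lecU _] := leq_card_setU [set j | (i, j) \in D] [set j in setT | (i, j) \in F].
by apply: leq_trans lecU _; rewrite leq_add2l; apply: card_preim_le => x y _ _ [].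
Qed.

Lemma cloadU D F j : cload (D :|: F) j <= cload D j + #|F|.
Proof.
apply: leq_trans (_ : #|[set i | (i, j) \in D] :|: [set i in setT | (i, j) \in F]| <= _).
  by apply: subset_leq_card; apply/subsetP=> i; rewrite !inE.
have [lecU _] := leq_card_setU [set i | (i, j) \in D] [set i in setT | (i, j) \in F].
by apply: leq_trans lecU _; rewrite leq_add2l; apply: card_preim_le => x y _ _ [].
Qed.

(* Markov's inequality applied twice. *)
Lemma few_heavy_rows (W : T -> T -> nat) k h :
  #|[set z | h <= #|[set y | k <= W z y]|]| * h * k <= \sum_z \sum_y W z y.
Proof.
have markov (f : T -> nat) a : #|[set y | a <= f y]| * a <= \sum_y f y.
  rewrite -sum_nat_const big_mkcond /=; apply: leq_sum => y _.
  by rewrite inE; case: ifP.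
apply: (@leq_trans (\sum_z #|[set y | k <= W z y]| * k)).
  by rewrite -big_distrl leq_mul2r /= markov orbT.
by apply: leq_sum => z _; apply: markov.
Qed.

End Averaging.

(** * Relocating a symbol within a row *)

Lemma card_set_seq (T : finType) (l : seq T) : #|[set x in l]| <= size l.
Proof. by rewrite cardsE card_size. Qed.

Lemma card_setU_le (T : finType) (X Y : {set T}) a b :
  #|X| <= a -> #|Y| <= b -> #|X :|: Y| <= a + b.
Proof.
by move=> leX leY; have [leU _] := leq_card_setU X Y; apply: leq_trans leU (leq_add leX leY).
Qed.

(** Each of at most 45 additional forbidden cells raises the seven loads by at most 7 in total, and
    316 = 7 * 45 + 1. *)
Lemma load_lt a a' b g K k :
  a' <= a + 7 * g -> b + a < K -> g <= 45 -> K + 316 <= k -> a' + 1 < k.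
Proof. lia. Qed.

Section Reloc.
Variables (T : finType) (n : nat).
Hypothesis cT : #|T| = n.
Implicit Types (L : T -> T -> T) (D F Pc : {set T * T}) (ls : {set T * T} -> T -> nat).

Definition put_load L D ls R C S :=
  cload D C + rload D (rw L C S) + 2 * ls D S + ls D (L R C) +
    rload D R + cload D (cl L R S).

(** This isolates what is used of [light_put], in a form that can be transposed. The larger set D'
    allows further cells to be forbidden. *)
Definition putable L D ls k := forall D' R C S, D \subset D' ->
  (R, C) \notin D' -> (R, cl L R S) \notin D' -> (rw L C S, C) \notin D' ->
  put_load L D' ls R C S + 1 < k ->
  exists Tr L', [/\ trade L Tr L', [disjoint Tr & D'], #|Tr| <= 10 & L' R C = S].

Definition symbol_load ls :=
  (forall D, \sum_s ls D s <= #|D|) /\ (forall D F s, ls (D :|: F) s <= ls D s + #|F|).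

Lemma put_loadU L D F ls R C S : symbol_load ls ->
  put_load L (D :|: F) ls R C S <= put_load L D ls R C S + 7 * #|F|.
Proof.
move=> [_ lsU]; rewrite /put_load.
have := lsU D F S; have := lsU D F (L R C).
have := rloadU D F R; have := rloadU D F (rw L C S).
have := cloadU D F C; have := cloadU D F (cl L R S); lia.
Qed.

Variables (L : T -> T -> T) (D Pc : {set T * T}) (ls : {set T * T} -> T -> nat).
Variables (k : nat) (r s : T).
Hypotheses (lL : latin L) (PcD : Pc \subset D) (lsP : symbol_load ls).
Hypothesis put : putable L D ls k.

Let c' := cl L r s.
Let p z := rw L c' (L r z).
Let q z := rw L z s.
Let v y := cl L y s.
Let m z y := cl L (p z) (L y c').

Definition reloc_cells z := [set (r, c'); (r, z); (p z, c'); (q z, z)].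

(* The cells of [reloc_cells] are determined by z and lie on the lines r, c', s,
   which may be heavily disturbed; the other cells of the trade can avoid F. *)
Definition relocatable z := z != c' /\ forall F, #|F| <= 32 ->
  [disjoint reloc_cells z & F] ->
  exists Tr L', [/\ trade L Tr L', [disjoint Tr & Pc :|: F], #|Tr| <= 30 & L' r z = s].

Let Dp := D :|: [set x : T * T | [|| x.1 == r, x.2 == c' | L x.1 x.2 == s]].

(** Two triples of cells that must be undisturbed for the light puts at (y, m) and (q, v), then two
    cells of the switches. Each entry is an injective function of (z, y), so at most #|Dp| pairs
    send it into [Dp]. *)
Definition reloc_generic z y :=
  [:: (y, m z y); (y, cl L y (L r z)); (rw L (m z y) (L r z), m z y);
      (q z, v y); (q z, cl L (q z) (L y z)); (rw L (v y) (L y z), v y);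
      (p z, m z y); (y, z)].

(** One number for two requirements: a weight below K means that no generic cell lies in [Dp] and
    that both put loads together stay below K. *)
Definition reloc_weight K z y :=
  K * count (mem Dp) (reloc_generic z y) +
  (put_load L Dp ls y (m z y) (L r z) + put_load L Dp ls (q z) (v y) (L y z)).

(* Write w = L r z and g = L y c'. Since the row p of w in column c' cannot be
   chosen freely, w is first moved in column c' from row p to row y: a light put
   of w at (y, m) creates an intercalate on rows p, y and columns c', m. To get s
   into (y, z), where b = L y z, a light put of b at (q, v) creates an intercalate
   on rows y, q and columns v, z. Finally rows r, y and columns c', z form an
   intercalate in s and w. Adding row r, column c' and the cells of s to Dp makes
   the cells of the light puts distinct from those of the switches. *)
Lemma reloc_at K z y F : z != c' -> K + 316 <= k -> #|F| <= 32 ->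
  [disjoint reloc_cells z & Pc :|: F] -> (r, c') \notin Pc ->
  reloc_weight K z y < K ->
  y \notin [set p z; r; q z; rw L c' (L (p z) z)] ->
  (y, c') \notin Pc :|: F -> (y, v y) \notin Pc :|: F ->
  all (fun x => x \notin F) (reloc_generic z y) ->
  exists Tr L', [/\ trade L Tr L', [disjoint Tr & Pc :|: F], #|Tr| <= 30 & L' r z = s].
Proof.
move=> zc' leK leF disF rc'Pc ltW ynot yc'P yvP gF.
have gD : all (fun x => x \notin Dp) (reloc_generic z y).
  rewrite -[all _ _](_ : ~~ has (mem Dp) (reloc_generic z y) = _); last first.
    by rewrite -all_predC.
  rewrite has_count -eqn0Ngt; apply: contraTT ltW => nz; rewrite -leqNgt /reloc_weight.
  by apply: (leq_trans _ (leq_addr _ _)); rewrite leq_pmulr ?lt0n.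
have lt_load : put_load L Dp ls y (m z y) (L r z) + put_load L Dp ls (q z) (v y) (L y z) < K.
  by apply: leq_ltn_trans ltW; apply: leq_addl.
move: gD gF; rewrite /= !andbT.
move=> /and5P[D1 D2 D3 D4 /and4P[D5 D6 D7 D8]] /and5P[F1 F2 F3 F4 /and4P[F5 F6 F7 F8]].
have Lrc' : L r c' = s by exact: clK.
have Lpc' : L (p z) c' = L r z by exact: rwK.
have Lqz : L (q z) z = s by exact: rwK.
have Lyv : L y (v y) = s by exact: clK.
have Lpm : L (p z) (m z y) = L y c' by exact: clK.
have Lym1 : L y (cl L y (L r z)) = L r z by exact: clK.
have Lp1m : L (rw L (m z y) (L r z)) (m z y) = L r z by exact: rwK.
have Lqv1 : L (q z) (cl L (q z) (L y z)) = L y z by exact: clK.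
have Lq1v : L (rw L (v y) (L y z)) (v y) = L y z by exact: rwK.
have rI i j1 j2 : L i j1 = L i j2 -> j1 = j2 by exact: lL.1.
have cI j i1 i2 : L i1 j = L i2 j -> i1 = i2 by exact: lL.2.
have [yp yr yq yg] : [/\ y <> p z, y <> r, y <> q z & L y c' <> L (p z) z].
  split=> E; move: ynot; rewrite !inE ?E ?eqxx ?orbT //.
  by rewrite -E rwE // eqxx orbT.
have inDp i j : [|| i == r, j == c' | L i j == s] -> (i, j) \in Dp.
  by move=> h; rewrite !inE /= h orbT.
move/eqP: zc' => zc'.
have mz : m z y <> z by move=> E; rewrite E in Lpm; apply: yg.
have mc' : m z y <> c' by move=> E; apply/yp/(cI c'); rewrite -[in LHS]Lpm E.
have vc' : v y <> c' by move=> E; apply/yr/(cI c'); rewrite Lrc' -[in LHS]E.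
have vz : v y <> z by move=> E; apply/yq/(cI z); rewrite Lqz -[in LHS]E.
have mv : m z y <> v y.
  by move=> E; move: D1; rewrite inDp // E Lyv eqxx !orbT.
have bs : L y z <> s by move=> E; apply/yq/(cI z); rewrite Lqz.
have bw : L y z <> L r z by move=> /cI.
have bg : L y z <> L y c' by move=> /rI.
have wg : L r z <> L y c' by move=> E; apply/yp/(cI c'); rewrite Lpc'.
have ws : L r z <> s by move=> E; apply/zc'/(rI r); rewrite Lrc'.
have rp : r <> p z by move=> E; apply: ws; rewrite -Lpc' -E.
have rq : r <> q z by move=> E; apply: ws; rewrite -Lqz -E.
clear rI cI ynot.
have sub0 : D \subset Dp by exact: subsetUl.
(* The put at (q, v) is chosen first and spares the cells needed for the put at (y, m), which in
   turn avoids all of T2. *)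
have [T2 [L2 [t2 dis2 le2 L2qv]]] : exists Tr L',
    [/\ trade L Tr L', [disjoint Tr & Dp :|: (F :|: [set x in [:: (p z, m z y); (y, m z y);
      (y, cl L y (L r z)); (rw L (m z y) (L r z), m z y); (y, z)]])],
      #|Tr| <= 10 & L' (q z) (v y) = L y z].
  set G := F :|: _.
  have leG : #|G| <= 37.
    by rewrite /G (leq_trans (card_setU_le leF (card_set_seq _))).
  apply: put; first by apply: subset_trans sub0 (subsetUl _ _).
  - rewrite inE negb_or D4 inE negb_or F4 /=; notin_cells.
  - rewrite inE negb_or D5 inE negb_or F5 /=; notin_cells.
  - rewrite inE negb_or D6 inE negb_or F6 /=; notin_cells.
  - by apply: load_lt (put_loadU L Dp G (q z) (v y) (L y z) lsP) lt_load _ leK; exact: leq_trans leG _.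
have [T1 [L1 [t1 dis1 le1 L1ym]]] : exists Tr L',
    [/\ trade L Tr L', [disjoint Tr & Dp :|: (F :|: T2 :|: [set x in [:: (p z, m z y); (y, z); (q z, v y)]])],
      #|Tr| <= 10 & L' y (m z y) = L r z].
  (* 32 + 10 + 3 = 45 cells, the bound in [load_lt]. *)
  set G := F :|: T2 :|: _.
  have leG : #|G| <= 45.
    by rewrite /G (leq_trans (card_setU_le (card_setU_le leF le2) (card_set_seq _))).
  have T2G x : x \in [set x in [:: (p z, m z y); (y, m z y);
      (y, cl L y (L r z)); (rw L (m z y) (L r z), m z y); (y, z)]] -> x \notin T2.
    by move=> xG; apply: contraL xG => xT; have := disjointFr dis2 xT; rewrite !in_setU => /norP[_ /norP[_ ->]].
  apply: put; first by apply: subset_trans sub0 (subsetUl _ _).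
  - rewrite inE negb_or D1 inE negb_or in_setU negb_or F1 T2G /=; last by rewrite !inE eqxx ?orbT.
    notin_cells.
  - rewrite inE negb_or D2 inE negb_or in_setU negb_or F2 T2G /=; last by rewrite !inE eqxx ?orbT.
    notin_cells.
  - rewrite inE negb_or D3 inE negb_or in_setU negb_or F3 T2G /=; last by rewrite !inE eqxx ?orbT.
    notin_cells.
  - by rewrite addnC in lt_load; apply: load_lt (put_loadU L Dp G y (m z y) (L r z) lsP) lt_load leG leK.
have dis12 : [disjoint T1 & T2].
  by apply: disjointWr dis1; apply/subsetP=> x xT; rewrite !in_setU xT !orbT.
have [L3 [t3 E1 E2]] := trade_par lL t1 t2 dis12.
have out1 x : x \in Dp :|: (F :|: T2 :|: [set x in [:: (p z, m z y); (y, z); (q z, v y)]]) -> x \notin T1.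
  by move=> xG; apply: contraL xG => xT; rewrite (disjointFr dis1).
have out2 x : x \in Dp :|: (F :|: [set x in [:: (p z, m z y); (y, m z y);
      (y, cl L y (L r z)); (rw L (m z y) (L r z), m z y); (y, z)]]) -> x \notin T2.
  by move=> xG; apply: contraL xG => xT; rewrite (disjointFr dis2).
have same i j : (i, j) \in Dp :|: [set (p z, m z y); (y, z)] -> L3 i j = L i j.
  move=> h; apply: t3.2; rewrite inE negb_or out1 ?out2 //.
    by move: h; rewrite !inE => /orP[->//|/orP[]->]; rewrite ?orbT.
  by move: h; rewrite !inE => /orP[->//|/orP[]->]; rewrite ?orbT.
have sameD i j : [|| i == r, j == c' | L i j == s] -> L3 i j = L i j.
  by move=> /inDp h; apply: same; rewrite inE h.
have pc3 : L3 (p z) c' = L r z by rewrite sameD ?eqxx ?orbT.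
have yc3 : L3 y c' = L y c' by rewrite sameD ?eqxx ?orbT.
have rc3 : L3 r c' = s by rewrite sameD ?eqxx ?orbT.
have rz3 : L3 r z = L r z by rewrite sameD ?eqxx ?orbT.
have yv3 : L3 y (v y) = s by rewrite sameD ?Lyv ?eqxx ?orbT.
have qz3 : L3 (q z) z = s by rewrite sameD ?Lqz ?eqxx ?orbT.
have pm3 : L3 (p z) (m z y) = L y c' by rewrite same // !inE eqxx ?orbT.
have yz3 : L3 y z = L y z by rewrite same // !inE eqxx ?orbT.
have ym3 : L3 y (m z y) = L r z.
  by rewrite E1 // out2 // !inE eqxx !orbT.
have qv3 : L3 (q z) (v y) = L y z.
  by rewrite E2 // out1 // !inE eqxx !orbT.
have [L4 [t4 _ [L4yc _]]] := @switch _ L3 (p z) y c' (m z y) t3.1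
  (introN eqP (nesym yp)) (etrans pc3 (esym ym3)) (etrans pm3 (esym yc3)).
have yv4 : L4 y (v y) = s by rewrite t4.2 //; notin_cells.
have yz4 : L4 y z = L y z by rewrite t4.2 //; notin_cells.
have qz4 : L4 (q z) z = s by rewrite t4.2 //; notin_cells.
have qv4 : L4 (q z) (v y) = L y z by rewrite t4.2 //; notin_cells.
have rc4 : L4 r c' = s by rewrite t4.2 //; notin_cells.
have rz4 : L4 r z = L r z by rewrite t4.2 //; notin_cells.
have [L5 [t5 [_ L5yz] _]] := @switch _ L4 y (q z) (v y) z t4.1
  (introN eqP yq) (etrans yv4 (esym qz4)) (etrans yz4 (esym qv4)).
have rc5 : L5 r c' = s by rewrite t5.2 //; notin_cells.
have rz5 : L5 r z = L r z by rewrite t5.2 //; notin_cells.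
have yc5 : L5 y c' = L r z by rewrite t5.2 ?L4yc //; notin_cells.
have yz5 : L5 y z = s by rewrite L5yz.
have [L6 [t6 [_ L6rz] _]] := @switch _ L5 r y c' z t5.1
  (introN eqP (nesym yr)) (etrans rc5 (esym yz5)) (etrans rz5 (esym yc5)).
(* Ten cells for the three switches and ten for each light put give the bound 30. *)
pose Tl := [:: (p z, c'); (p z, m z y); (y, c'); (y, m z y); (y, v y); (y, z);
  (q z, v y); (q z, z); (r, c'); (r, z)].
exists (T1 :|: T2 :|: [set x in Tl]), L6; split.
- apply: (trade_sub (trade_trans (trade_trans (trade_trans t3 t4) t5) t6)).
  apply/subsetP=> x; rewrite !inE.
  by repeat case/orP; move=> ->; rewrite ?orbT.
- rewrite disjoint_subset; apply/subsetP=> x; rewrite in_setU => /orP[]; last first.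
    have nP i j : (i, j) \notin Dp -> (i, j) \notin F -> (i, j) \notin Pc :|: F.
      move=> h1 h2; rewrite in_setU negb_or h2 andbT.
      by apply: contra h1 => /(subsetP PcD) h1; rewrite inE h1.
    have nC i j : (i, j) \in reloc_cells z -> (i, j) \notin Pc :|: F.
      by move=> h; rewrite (disjointFr disF h).
    rewrite inE => xl; rewrite inE; move: xl.
    do 10! (case/predU1P => [->|]; first by [|apply: nP|apply: nC; rewrite !inE eqxx ?orbT]).
    by [] .
  have PF : Pc :|: F \subset Dp :|: F.
    by apply: setSU; apply: subset_trans PcD sub0.
  rewrite inE => /orP[] xT.
    have := disjointFr dis1 xT; apply: contraFN => /(subsetP PF).
    by rewrite !in_setU => /orP[]->; rewrite ?orbT.
  have := disjointFr dis2 xT; apply: contraFN => /(subsetP PF).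
  by rewrite !in_setU => /orP[]->; rewrite ?orbT.
- exact: (leq_trans (card_setU_le (card_setU_le le1 le2) (card_set_seq _))).
- by rewrite L6rz.
Qed.

(** Injectivity in one parameter is enough to average: for each value of the other one, the line
    [h z y] runs over all lines once. *)
Definition spread (h : T -> T -> T) :=
  (forall z, injective (h z)) \/ (forall y, injective (h^~ y)).

Lemma sum_spread (ld : T -> nat) h : spread h ->
  \sum_z \sum_y ld (h z y) = n * \sum_y ld y.
Proof. by case=> sp; [apply: sum_load_row | apply: sum_load_col]. Qed.

Lemma sum_put_load X (R C S : T -> T -> T) : spread R -> spread C -> spread S ->
  spread (fun z y => rw L (C z y) (S z y)) -> spread (fun z y => L (R z y) (C z y)) ->
  spread (fun z y => cl L (R z y) (S z y)) ->
  \sum_z \sum_y put_load L X ls (R z y) (C z y) (S z y) <= 7 * (n * #|X|).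
Proof.
move=> sR sC sS sR' sA sC'.
have [lsX _] := lsP.
have -> : \sum_z \sum_y put_load L X ls (R z y) (C z y) (S z y) =
  \sum_z \sum_y cload X (C z y) + \sum_z \sum_y rload X (rw L (C z y) (S z y)) +
  2 * (\sum_z \sum_y ls X (S z y)) + \sum_z \sum_y ls X (L (R z y) (C z y)) +
  \sum_z \sum_y rload X (R z y) + \sum_z \sum_y cload X (cl L (R z y) (S z y)).
  rewrite big_distrr -!big_split; apply: eq_bigr => z _ /=.
  by rewrite big_distrr -!big_split; apply: eq_bigr => y _.
have lsn h : spread h -> \sum_z \sum_y ls X (h z y) <= n * #|X|.
  by move=> /sum_spread ->; rewrite leq_mul2l lsX orbT.
have := lsn _ sS; have := lsn _ sA; rewrite !sum_spread // ?sum_rload ?sum_cload //.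
move: (\sum_z \sum_y ls X (S z y)) (\sum_z \sum_y ls X (L (R z y) (C z y))) (n * _) => a b x.
clear; lia.
Qed.

Let clI i : injective (cl L i).
Proof. by move=> s1 s2 E; rewrite -(clK i s1 lL) E clK. Qed.

Let rwI j : injective (rw L j).
Proof. by move=> s1 s2 E; rewrite -(rwK j s1 lL) E rwK. Qed.

Let clIl t : injective (cl L ^~ t).
Proof. by move=> i1 i2 /= E; apply: (lL.2 (cl L i2 t)); rewrite /= -{1}E !clK. Qed.

Let rwIl t : injective (rw L ^~ t).
Proof. by move=> j1 j2 /= E; apply: (lL.1 (rw L j2 t)); rewrite /= -{1}E !rwK. Qed.

Let pI : injective p.
Proof. by move=> z1 z2 /rwI /lL.1. Qed.

Let mIr z : injective (m z).
Proof. by move=> y1 y2 /clI /(lL.2 c'). Qed.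

Let mIl y : injective (m^~ y).
Proof. by move=> z1 z2 /clIl /pI. Qed.

(** The eight generic cells contribute 8 K #|Dp|, and each of the two put loads consists of seven
    spread loads of total at most n #|Dp|. *)
Lemma sum_reloc_weight K :
  \sum_z \sum_y reloc_weight K z y <= (8 * K + 14 * n) * #|Dp|.
Proof.
have w1 : \sum_z \sum_y put_load L Dp ls y (m z y) (L r z) <= 7 * (n * #|Dp|).
  apply: sum_put_load.
  - by left=> z y1 y2.
  - by left; exact: mIr.
  - by right=> y; exact: lL.1.
  - by left=> z y1 y2 /rwIl /mIr.
  - by right=> y z1 z2 /lL.1 /mIl.
  - by right=> y z1 z2 /clI /lL.1.
have w2 : \sum_z \sum_y put_load L Dp ls (q z) (v y) (L y z) <= 7 * (n * #|Dp|).
  apply: sum_put_load.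
  - by right=> y z1 z2 /rwIl.
  - by left=> z y1 y2 /clIl.
  - by right=> y z1 z2 /lL.1.
  - by right=> y z1 z2 /rwI /lL.1.
  - by left=> z y1 y2 /lL.1 /clIl.
  - by left=> z y1 y2 /clI /(lL.2 z).
have sc : \sum_z \sum_y count (mem Dp) (reloc_generic z y) <= 8 * #|Dp|.
  have -> : \sum_z \sum_y count (mem Dp) (reloc_generic z y) =
      \sum_(i < 8) \sum_z \sum_y (nth (r, r) (reloc_generic z y) i \in Dp : nat).
    rewrite [RHS]exchange_big; apply: eq_bigr => z _ /=.
    rewrite [RHS]exchange_big; apply: eq_bigr => y _ /=.
    by rewrite !big_ord_recr big_ord0 /= add0n addn0 !addnA.
  rewrite -[8 in leqRHS]card_ord -sum_nat_const; apply: leq_sum => i _.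
  apply: sum_mem_inj => z1 y1 z2 y2.
  case: i => -[|[|[|[|[|[|[|[|//]]]]]]]] _ /=.
  - by case=> <- /mIl.
  - by case=> <- /clI/lL.1.
  - case=> E1 E2; rewrite E2 in E1; have E := rwI E1; have Ez := lL.1 r _ _ E.
    by split=> //; rewrite Ez in E2; apply: mIr E2.
  - by case=> /rwIl -> /clIl.
  - by case=> /rwIl -> /clI /(lL.2 z2).
  - by case=> E1 /clIl E2; move: E1; rewrite E2 => /rwI /lL.1.
  - by case=> /pI -> /mIr.
  - by case.
have -> : \sum_z \sum_y reloc_weight K z y =
    K * (\sum_z \sum_y count (mem Dp) (reloc_generic z y)) +
    (\sum_z \sum_y put_load L Dp ls y (m z y) (L r z) +
     \sum_z \sum_y put_load L Dp ls (q z) (v y) (L y z)).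
  rewrite big_distrr -!big_split; apply: eq_bigr => z _ /=.
  by rewrite big_distrr -!big_split; apply: eq_bigr => y _.
have := leq_mul (leqnn K) sc; rewrite mulnDl mulnA [K * 8]mulnC => h.
by apply: leq_add h _; apply: leq_trans (leq_add w1 w2) _; rewrite -mulnDl mulnA.
Qed.

Lemma card_symbol t : #|[set x : T * T | L x.1 x.2 == t]| = n.
Proof.
rewrite -cT -cardsT -(@card_imset _ _ (fun i => (i, cl L i t)) setT); last by move=> ? ? [].
apply: eq_card => -[i j]; rewrite !inE /=; apply/eqP/imsetP => [<-|[i' _ [-> ->]]].
  by exists i; rewrite ?clE.
by rewrite clK.
Qed.

Lemma card_Dp : #|Dp| <= #|D| + 3 * n.
Proof.
have -> : Dp = D :|: ([set (r, j) | j in [set: T]] :|: [set (i, c') | i in [set: T]]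
    :|: [set x | L x.1 x.2 == s]).
  congr (_ :|: _); apply/setP=> -[i j]; rewrite !inE /= -orbA.
  have -> : ((i, j) \in [set (r, j0) | j0 in [set: T]]) = (i == r).
    by apply/imsetP/eqP => [[j' _ [->]]|->] //; exists j.
  have -> // : ((i, j) \in [set (i0, c') | i0 in [set: T]]) = (j == c').
  by apply/imsetP/eqP => [[i' _ [_ ->]]|->] //; exists i.
apply: card_setU_le => //; rewrite -[3 * n]/(n + (n + (n + 0))) addn0 addnA.
apply: card_setU_le; last by rewrite card_symbol.
by apply: card_setU_le; rewrite -cT -cardsT leq_imset_card.
Qed.

(** E contains c', the z for which a cell of [reloc_cells z] lies in Pc, at most e for each of the
    lines r, c' and s, and the z with at least h heavy y. Markov's inequality and [sum_reloc_weight]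
    bound the last kind. *)
Lemma reloc_few K h e : K + 316 <= k -> h + 2 * e + 324 < n -> (r, c') \notin Pc ->
  rload Pc r <= e -> cload Pc c' <= e -> #|[set x in Pc | L x.1 x.2 == s]| <= e ->
  exists (E : {set T}) X, [/\ forall z, z \notin E -> relocatable z,
    #|E| <= 1 + 3 * e + X & X * h * K <= (8 * K + 14 * n) * (#|D| + 3 * n)].
Proof.
move=> leK leh rc'Pc rPc cPc sPc.
pose heavy z := [set y | K <= reloc_weight K z y].
pose E0 := [set z | h <= #|heavy z|].
pose E := [set c'] :|: [set z | (r, z) \in Pc] :|: [set z | (p z, c') \in Pc]
  :|: [set z | (q z, z) \in Pc] :|: E0.
exists E, #|E0|; split; last 2 first.
- rewrite -[3 * e]/(e + (e + (e + 0))) addn0 !addnA.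
  apply: card_setU_le => //; apply: card_setU_le; last first.
    apply: leq_trans sPc; rewrite -(@card_imset _ _ (fun z => (q z, z))); last by move=> ? ? [].
    by apply: subset_leq_card; apply/subsetP=> x /imsetP[z]; rewrite !inE => zP -> /=; rewrite zP rwK /=.
  apply: card_setU_le; last first.
    apply: leq_trans cPc; rewrite -(card_imset _ pI).
    by apply: subset_leq_card; apply/subsetP=> x /imsetP[z]; rewrite !inE => zP -> /=.
  by apply: card_setU_le => //; rewrite cards1.
- apply: leq_trans (few_heavy_rows _ _ _) _; apply: leq_trans (sum_reloc_weight K) _.
  by rewrite leq_mul2l card_Dp orbT.
move=> z; rewrite !in_setU !negb_or !inE -!andbA -ltnNge => /and5P[zc' n1 n2 n3 ltz].
split=> // F leF disF.
have [Y defY] : {Y : {set T} | Y = [set p z; r; q z; rw L c' (L (p z) z)]} by eexists.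
pose B1 := [set y | (y, c') \in Pc]; pose B2 := [set y | (y, v y) \in Pc].
pose B3 := [set y | (y, c') \in F]; pose B4 := [set y | (y, v y) \in F].
pose Bg (i : nat) := [set y in setT | nth (r, r) (reloc_generic z y) i \in F].
(* At most h + 4 + e + e + 32 + 32 + 8 * 32 = h + 2e + 324 values of y are bad. *)
pose Bad := heavy z :|: Y :|: B1 :|: B2 :|: B3 :|: B4 :|: \bigcup_(i < 8) Bg i.
have b3 : #|B3| <= 32.
  apply: leq_trans leF; apply: leq_trans (@card_preim_le _ _ setT F (fun y => (y, c')) _).
    by apply: subset_leq_card; apply/subsetP=> y; rewrite !inE.
  by move=> ? ? _ _ [].
have b4 : #|B4| <= 32.
  apply: leq_trans leF; apply: leq_trans (@card_preim_le _ _ setT F (fun y => (y, v y)) _).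
    by apply: subset_leq_card; apply/subsetP=> y; rewrite !inE.
  by move=> ? ? _ _ [].
have b2 : #|B2| <= e.
  apply: leq_trans sPc; rewrite -(@card_imset _ _ (fun y => (y, v y))); last by move=> ? ? [].
  by apply: subset_leq_card; apply/subsetP=> x /imsetP[y]; rewrite !inE => yP -> /=; rewrite yP clK /=.
have bg : #|\bigcup_(i < 8) Bg i| <= 256.
  apply: (@leq_trans (\sum_(i < 8) 32)); last by rewrite sum_nat_const card_ord.
  apply: (big_ind2 (fun (X : {set T}) a => #|X| <= a)); first by rewrite cards0.
    by move=> X1 x1 X2 x2 /card_setU_le h1 /h1.
  move=> i _; apply: leq_trans leF; apply: card_preim_le => y1 y2 _ _.
  case: i => -[|[|[|[|[|[|[|[|//]]]]]]]] _ /=.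
  - by case.
  - by case.
  - by case=> _ /mIr.
  - by case=> /clIl.
  - by case=> /clI /(lL.2 z).
  - by case=> _ /clIl.
  - by case=> /mIr.
  - by case.
have cY : #|Y| <= 4 by rewrite defY !cardsU !cards1; clear; lia.
have ltBad : #|Bad| < n.
  have := card_setU_le (card_setU_le (card_setU_le (card_setU_le (card_setU_le
    (card_setU_le (ltnW ltz) cY) cPc) b2) b3) b4) bg.
  rewrite -/Bad; move: leh; clear; lia.
have /properP[_ [y _ yB]] : Bad \proper [set: T] by rewrite properEcard subsetT cardsT cT.
move: yB; rewrite !in_setU !negb_or -!andbA => /and5P[y1 y2 y3 y4 /and3P[y5 y6 y7]].
apply: (@reloc_at K z y) => //.
- rewrite disjoint_subset; apply/subsetP=> x xC; rewrite !inE (disjointFr disF xC) orbF.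
  by move: xC; rewrite !inE -!orbA => /or4P[] /eqP->.
- by rewrite inE -ltnNge in y1.
- by rewrite -defY.
- by rewrite !inE in y3 y5 *; rewrite negb_or y3.
- by rewrite !inE in y4 y6 *; rewrite negb_or y4.
apply/(all_nthP (r, r)) => i ilt; apply: contra y7 => iF.
by apply/bigcupP; exists (Ordinal ilt) => //; rewrite !inE.
Qed.

End Reloc.

(** * Correcting one cell *)

Section Transpose.
Variable T : finType.
Implicit Types (L : T -> T -> T) (X Y : {set T * T}).

Definition tset X := [set x : T * T | (x.2, x.1) \in X].

Lemma in_tset X i j : ((i, j) \in tset X) = ((j, i) \in X).
Proof. by rewrite inE. Qed.

Lemma tsetK : involutive tset.
Proof. by move=> X; apply/setP=> -[i j]; rewrite !inE. Qed.

Lemma card_tset X : #|tset X| = #|X|.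
Proof.
have le Y : #|tset Y| <= #|Y|.
  rewrite -(@card_imset _ _ (fun x : T * T => (x.2, x.1))); last by move=> [? ?] [? ?] [-> ->].
  by apply: subset_leq_card; apply/subsetP=> x /imsetP[y]; rewrite inE => yY ->.
by apply/eqP; rewrite eqn_leq le /= -{1}(tsetK X) le.
Qed.

Lemma tsetU X Y : tset (X :|: Y) = tset X :|: tset Y.
Proof. by apply/setP=> x; rewrite !inE. Qed.

Lemma tset_sub X Y : X \subset Y -> tset X \subset tset Y.
Proof. by move/subsetP=> sub; apply/subsetP=> x; rewrite !inE => /sub. Qed.

Lemma disjoint_tset X Y : [disjoint tset X & Y] = [disjoint X & tset Y].
Proof.
rewrite -!setI_eq0; apply/eqP/eqP=> /setP E; apply/setP=> -[i j].
  by have := E (j, i); rewrite !inE.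
by have := E (j, i); rewrite !inE.
Qed.

Definition tsq L i j := L j i.

Lemma latin_tsq L : latin L -> latin (tsq L).
Proof. by case. Qed.

Lemma trade_tsq L L' X : trade L X L' -> trade (tsq L) (tset X) (tsq L').
Proof. by move=> [[l1 l2] E]; split=> // i j; rewrite in_tset => /E. Qed.

(** Transposition exchanges [cl] with [rw] and [rload] with [cload], which leaves the put load
    unchanged. Hence [reloc_few] also moves symbols within a column. *)
Lemma putable_tsq L X ls k :
  putable L X ls k -> putable (tsq L) (tset X) (fun Y => ls (tset Y)) k.
Proof.
move=> put Y R C S subY n1 n2 n3 ltk.
have [|||||Tr [L' [t dis le E]]] := put (tset Y) C R S; rewrite ?in_tset //.
- by rewrite -(tsetK X) tset_sub.
- apply: leq_ltn_trans ltk; rewrite leq_add2r /put_load.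
  have rl i : rload (tset Y) i = cload Y i by apply: eq_card => j; rewrite !inE.
  have cl' i : cload (tset Y) i = rload Y i by apply: eq_card => j; rewrite !inE.
  by rewrite !rl !cl' /tsq /rw /cl; lia.
exists (tset Tr), (tsq L'); split=> //.
- exact: trade_tsq.
- by rewrite disjoint_tset.
by rewrite card_tset.
Qed.

Lemma symbol_load_tsq (ls : {set T * T} -> T -> nat) :
  symbol_load ls -> symbol_load (fun Y => ls (tset Y)).
Proof.
move=> [l1 l2]; split=> [X|X Y s]; first by rewrite -(card_tset X).
by rewrite tsetU -(card_tset Y).
Qed.

End Transpose.

Section Step.
Variables (T : finType) (n : nat).
Hypothesis cT : #|T| = n.

Lemma put_cell L (D Pc : {set T * T}) ls k K h e r c s :
  latin L -> Pc \subset D -> symbol_load ls -> putable L D ls k ->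
  L r c != s ->
  (r, c) \notin Pc -> (r, cl L r s) \notin Pc -> (rw L c s, c) \notin Pc ->
  (forall i, rload Pc i <= e) -> (forall j, cload Pc j <= e) ->
  (forall t, #|[set x in Pc | L x.1 x.2 == t]| <= e) ->
  K + 316 <= k -> h + 2 * e + 324 < n ->
  (forall X, X * h * K <= (8 * K + 14 * n) * (#|D| + 3 * n) -> 7 * e + 2 * X + 5 < n) ->
  exists Tr L', [/\ trade L Tr L', [disjoint Tr & Pc], #|Tr| <= 64 & L' r c = s].
Proof.
move=> lL PcD lsP put nes rcP rc'P r'cP rPc cPc sPc leK leh arith.
have [E1 [X1 [reloc1 leE1 leX1]]] :=
  reloc_few cT lL PcD lsP put leK leh rc'P (rPc _) (cPc _) (sPc s).
have tPc t : #|[set x in tset Pc | tsq L x.1 x.2 == t]| <= e.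
  rewrite -(card_tset [set x in tset Pc | _]).
  rewrite (_ : tset _ = [set x in Pc | L x.1 x.2 == t]) //.
  by apply/setP=> -[i j]; rewrite !inE.
have rl i : rload (tset Pc) i <= e.
  by rewrite (_ : rload _ i = cload Pc i) //; apply: eq_card => j; rewrite !inE.
have cl' i : cload (tset Pc) i <= e.
  by rewrite (_ : cload _ i = rload Pc i) //; apply: eq_card => j; rewrite !inE.
have r'cPt : (c, cl (tsq L) c s) \notin tset Pc by rewrite in_tset.
have [E2 [X2 [reloc2 leE2 leX2]]] :=
  reloc_few cT (latin_tsq lL) (tset_sub PcD) (symbol_load_tsq lsP) (putable_tsq put)
    leK leh r'cPt (rl _) (cl' _) (tPc s).
rewrite card_tset in leX2.
pose a := L r c; pose z x := cl L x a; pose c' := cl L r s; pose r' := rw L c s.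
have Lxz x : L x (z x) = a by exact: clK.
have Lrc' : L r c' = s by exact: clK.
have Lr'c : L r' c = s by exact: rwK.
have zI : injective z.
  by move=> x y E; apply: (lL.2 (z y)); rewrite /= -{1}E !Lxz.
(* B1 and E2 exclude failures of the row and the column move, B2 a correct cell at (x, z), and B3 a
   coincidence of the cells (p, c') and (r', p2) of the two moves. *)
pose B1 := [set x in setT | z x \in E1].
pose B2 := [set x in setT | (x, z x) \in [set y in Pc | L y.1 y.2 == a]].
pose B3 := [set x in setT | L r (z x) \in [set L r' c']].
pose Bad := [set x in [:: r; r']] :|: B1 :|: E2 :|: B2 :|: B3.
have b1 : #|B1| <= #|E1| by apply: card_preim_le => x y _ _ /zI.
have b2 : #|B2| <= e.
  by apply: leq_trans (sPc a); apply: card_preim_le => x y _ _ [].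
have b3 : #|B3| <= 1.
  by rewrite -(cards1 (L r' c')); apply: card_preim_le => x y _ _ /(lL.1 r) /zI.
have ltBad : #|Bad| < n.
  (* The total is 2 + (1 + 3e + X1) + (1 + 3e + X2) + e + 1; [arith] is applied to X1 and to X2. *)
  have := card_setU_le (card_setU_le (card_setU_le (card_setU_le
    (card_set_seq [:: r; r']) (leq_trans b1 leE1)) leE2) b2) b3.
  move/leq_ltn_trans; apply; rewrite /=.
  by have := arith _ leX1; have := arith _ leX2; clear; lia.
have /properP[_ [x _ xB]] : Bad \proper [set: T].
  by rewrite properEcard subsetT cardsT cT.
move: xB; rewrite !in_setU !negb_or -!andbA => /and5P[xrr' xE1 xE2 xPc xw].
have {xE1} [zc' rel1] : relocatable L Pc r s (z x).
  by apply: reloc1; apply: contra xE1 => h1; rewrite inE inE.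
have {xE2} [xr'2 rel2] := reloc2 _ xE2.
have {}xPc : (x, z x) \notin Pc by apply: contra xPc => h1; rewrite !inE /= h1 Lxz eqxx.
have {xw} xw : L r (z x) <> L r' c' by move/eqP=> h1; rewrite !inE h1 in xw.
have [xr xr'] : x <> r /\ x <> r'.
  by split=> E; rewrite E !inE eqxx ?orbT in xrr'.
move: (z x) (Lxz x) zc' rel1 xPc xw => {zI B1 B2 B3 Bad b1 b2 b3 ltBad xrr' xr'2} zz Lxz' zc' rel1 xPc xw.
have {zc'} zc' : zz <> c' by apply/eqP.
have zc : zz <> c by move=> E; apply: xr; apply: (lL.2 c); rewrite /= -[in LHS]E.
have cc' : c <> c' by move=> E; case/eqP: nes; rewrite E.
have rr' : r <> r' by move=> E; case/eqP: nes; rewrite E.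
have as_ : a <> s by apply/eqP.
pose p := rw L c' (L r zz); pose q := rw L zz s.
pose p2 := cl L r' (L x c); pose q2 := cl L x s.
have Lpc' : L p c' = L r zz by exact: rwK.
have Lqz : L q zz = s by exact: rwK.
have Lr'p2 : L r' p2 = L x c by exact: clK.
have Lxq2 : L x q2 = s by exact: clK.
have pr' : p <> r' by move=> E; apply: xw; rewrite -Lpc' E.
have q2c' : q2 <> c' by move=> E; apply: xr; apply: (lL.2 c'); rewrite /= Lrc' -[in LHS]E.
have qr' : q <> r' by move=> E; apply: zc; apply: (lL.1 r'); rewrite Lr'c -[in LHS]E.
have q2z : q2 <> zz by move=> E; apply: as_; rewrite -Lxz' -E.
have qx : q <> x by move=> E; apply: as_; rewrite -Lxz' -E.
(* The column move is chosen first, clear of the cells that the row move must use and of two corners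
   of the final intercalate. *)
pose G := [set y in [:: (r, c'); (r, zz); (p, c'); (q, zz); (r, c); (x, zz)]].
have [||T2' [L2' [t2' dis2' le2' L2cx]]] := rel2 (tset G).
- by rewrite card_tset (leq_trans (card_set_seq _)).
- rewrite -disjoint_tset.
  have -> : tset (reloc_cells (tsq L) c s x) = [set (r', c); (x, c); (r', p2); (x, q2)].
    by apply/setP=> -[i j]; rewrite !inE /= !xpair_eqE ![(j == _) && _]andbC.
  by disjoint_cells.
pose T2 := tset T2'; pose L2 := tsq L2'.
have t2 : trade L T2 L2 by have := trade_tsq t2'.
have dis2 : [disjoint T2 & Pc :|: G].
  by rewrite /T2 disjoint_tset tsetU.
have le2 : #|T2| <= 30 by rewrite card_tset.
have out2 y : y \in G -> y \notin T2.
  by move=> yG; apply/negP=> /(disjointFr dis2); rewrite in_setU yG orbT.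
(* The 30 cells of T2 and two corners account for the bound 32 in [relocatable]. *)
have [||T1 [L1 [t1 dis1 le1 L1rz]]] := rel1 (T2 :|: [set y in [:: (r, c); (x, zz)]]).
- exact: (leq_trans (card_setU_le le2 (card_set_seq _))).
- have -> : reloc_cells L r s zz = [set (r, c'); (r, zz); (p, c'); (q, zz)] by [].
  rewrite disjoint_subset; apply/subsetP=> y yC; rewrite inE in_setU negb_or.
  rewrite out2; last by move: yC; rewrite !inE -!orbA => /or4P[] ->; rewrite ?orbT.
  by move: yC; rewrite !inE -!orbA => /or4P[] /eqP->; notin_cells.
have out1 y : y \in [set y in [:: (r, c); (x, zz)]] -> y \notin T1.
  by move=> yG; apply/negP=> /(disjointFr dis1); rewrite !in_setU yG !orbT.
have dis12 : [disjoint T1 & T2].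
  by apply: disjointWr dis1; apply/subsetP=> y yT; rewrite !in_setU yT orbT.
have [L3 [t3 e1 e2]] := trade_par lL t1 t2 dis12.
have rc3 : L3 r c = a.
  by rewrite e1 ?t1.2 // ?out1 ?out2 // !inE eqxx ?orbT.
have xz3 : L3 x zz = a.
  by rewrite e1 ?t1.2 // ?out1 ?out2 // !inE eqxx ?orbT.
have rz3 : L3 r zz = s by rewrite e1 // out2 // !inE eqxx ?orbT.
(* This cell must change, as column c of L has its s in row r' and not in row x. *)
have xcT2 : (x, c) \in T2.
  apply: contraTT isT => nT; case: xr'; apply: (lL.2 c).
  by rewrite /= Lr'c -(t2.2 _ _ nT).
have rzT1 : (r, zz) \in T1.
  apply: contraTT isT => nT; case: zc'; apply: (lL.1 r).
  by rewrite Lrc' -(t1.2 _ _ nT).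
have xc3 : L3 x c = s by rewrite e2 // (disjointFl dis12 xcT2).
have [L4 [t4 [L4rc _] _]] := @switch _ L3 r x c zz t3.1 (introN eqP (nesym xr))
  (etrans rc3 (esym xz3)) (etrans rz3 (esym xc3)).
exists (T1 :|: T2 :|: [set y in [:: (r, c); (r, zz); (x, c); (x, zz)]]), L4; split.
- apply: (trade_sub (trade_trans t3 t4)).
  by apply/subsetP=> y; rewrite !inE -!orbA.
- have nP1 y : y \in T1 -> y \notin Pc.
    by move=> yT; have := disjointFr dis1 yT; rewrite in_setU => /negbT/norP[].
  have nP2 y : y \in T2 -> y \notin Pc.
    by move=> yT; have := disjointFr dis2 yT; rewrite in_setU => /negbT/norP[].
  rewrite disjoint_subset; apply/subsetP=> y; rewrite in_setU in_setU.
  case/orP=> [/orP[/nP1|/nP2]|]; rewrite ?inE // => yl; rewrite ?inE.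
  by move: yl; case/or4P=> /eqP-> //; [apply: nP1 | apply: nP2].
- exact: (leq_trans (card_setU_le (card_setU_le le1 le2) (card_set_seq _))).
by rewrite L4rc.
Qed.

End Step.

(** * Latin squares close to the dihedral table *)

Lemma card_inj_exists (A B : finType) : #|A| <= #|B| -> exists f : A -> B, injective f.
Proof.
move=> leAB; exists (fun x => enum_val (widen_ord leAB (enum_rank x))) => x y.
by move/enum_val_inj/(congr1 val) => /= E; apply/enum_rank_inj/val_inj.
Qed.

(** * A near transversal of the dihedral table *)

Section Transversal.
Variable k' : nat.
Local Notation k := k'.+2.
Local Notation Z := 'I_k.
Let h := k./2.

Let kh : k = h + h \/ k = (h + h).+1.
Proof. by rewrite /h; have := odd_double_half k; case: (odd k); lia. Qed.

Lemma natr_inj_window w x y : w <= x < w + k -> w <= y < w + k ->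
  (x%:R = y%:R :> Z)%R -> x = y.
Proof.
wlog le_xy : x y / x <= y => [H|].
  case: (leqP x y) => [|/ltnW] le hx hy E; first exact: H.
  by apply/esym/H.
move=> hx hy; rewrite !Zp_nat => /(congr1 val) /= /eqP; rewrite eq_sym eqn_mod_dvd //.
by case: (posnP (y - x)) => [|lt0 /dvdn_leq]; [lia | move=> /(_ lt0); lia].
Qed.

(* A partial transversal missing at most one row: the cells (u, tcol u). The odd
   type with u.2 >= 2h occurs for odd k only. *)
Definition tcol (u : bool * Z) : bool * Z :=
  if u.2 < h then (u.1, (u.2 + u.1)%:R%R)
  else (~~ u.1, (k + h - u.1 - u.2)%:R%R).

Definition tdom (u : bool * Z) := ~~ [&& u.1 & h + h <= u.2].

Let sym_nat (u : bool * Z) : nat :=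
  if u.2 < h then u.2 + u.2 + u.1 else k + k + h - u.1 - u.2 - u.2.

Let tsymE u : tdom u -> dop u (tcol u) = (h <= u.2, (sym_nat u)%:R%R).
Proof.
case: u => b [i ik]; rewrite /tdom /dop /tcol /sym_nat /=.
have natI : (Ordinal ik = i%:R :> Z)%R.
  by rewrite Zp_nat; apply: val_inj; rewrite /= modn_small.
have k0 : (k%:R = 0 :> Z)%R by rewrite Zp_nat; apply: val_inj; rewrite /= modnn.
case: ltnP => hi; rewrite natI /= => nb.
  by case: b {nb}; rewrite /= -natrD; congr (_, (_)%:R)%R; lia.
have lehk : h <= k by case: kh => ->; lia.
have -> : (k + k + h - b - i - i = (k + h - b - i) + (k - i))%N.
  by case: kh => kE; case: b nb => /= nb; lia.
by rewrite natrD [((k - i)%:R)%R]natrB 1?ltnW // k0 sub0r; case: b {nb}.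
Qed.

(** In columns of type [false], the rows with [u.2 < h] fill the positions 0 to h - 1 and the others
    lie in h to k - 1. In type [true] both intervals are shifted by 1, hence the windows starting at
    0 or 1. *)
Lemma tcol_inj u1 u2 : tdom u1 -> tdom u2 -> tcol u1 = tcol u2 -> u1 = u2.
Proof.
case: u1 => b1 [i1 ik1]; case: u2 => b2 [i2 ik2]; rewrite /tdom /tcol /=.
move=> n1 n2 E; have := congr1 snd E; have := congr1 fst E => {E}.
have solve x y (c1 c2 : bool) : c1 = c2 -> (c1 = c2 -> exists w, [/\ w <= x < w + k, w <= y < w + k
    & x = y -> b1 = b2 /\ i1 = i2]) -> (x%:R = y%:R :> Z)%R ->
    (b1, Ordinal ik1) = (b2, Ordinal ik2).
  move=> c12 [] // w [wx wy xy] /(natr_inj_window wx wy)/xy[-> i12].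
  by congr (_, _); apply: val_inj.
case: ifP => h1; case: ifP => h2 /= t; apply: (solve _ _ _ _ t) => {solve}; case: b1 n1 t => /= n1 t;
  case: b2 n2 t => //= n2 _.
- by exists 1; split; lia.
- by exists 0; split; lia.
- by exists 1; split; case: kh => kE; lia.
- by exists 0; split; case: kh => kE; lia.
- by exists 0; split; case: kh => kE; lia.
- by exists 1; split; case: kh => kE; lia.
- by exists 0; split; case: kh => kE; lia.
- by exists 1; split; case: kh => kE; lia.
Qed.

(** The type of the symbol tells whether [u.2 < h]. Within each half the parity of [sym_nat] tells
    the type of u, and its values lie in a window of length k. *)
Lemma tsym_inj u1 u2 : tdom u1 -> tdom u2 ->
  dop u1 (tcol u1) = dop u2 (tcol u2) -> u1 = u2.
Proof.
move=> n1 n2; rewrite !tsymE // => E; have := congr1 snd E; have := congr1 fst E => {E}.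
case: u1 n1 => b1 [i1 ik1]; case: u2 n2 => b2 [i2 ik2]; rewrite /tdom /sym_nat /= => n2 n1 t E.
suff [-> i12] : b1 = b2 /\ i1 = i2 by congr (_, _); apply: val_inj.
move: t E; case: (ltnP i1 h) => h1; case: (ltnP i2 h) => h2 //= _ E.
  by have := @natr_inj_window 0 _ _ _ _ E; move: E => _; case: b1 n1; case: b2 n2 => /= n1 n2; case: kh => kE E; split=> //; lia.
(* The values lie in (k - h, 2k - h]. For odd k the row excluded by [tdom] would give k - h, which
   clashes with the value 2k - h of (false, h). *)
have E2 := @natr_inj_window (k - h).+1 _ _ _ _ E; move: E => _.
by case: b1 n1 E2; case: b2 n2 => /= n1 n2; case: kh => kE E; split=> //; lia.
Qed.

Lemma card_tdom : k + k <= #|[set u | tdom u]|.+1.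
Proof.
have cK : #|{: bool * Z}| = k + k by rewrite card_prod card_bool card_ord mul2n addnn.
suff : #|~: [set u | tdom u]| <= 1.
  by have := cardsC [set u | tdom u]; rewrite cK; lia.
apply/card_le1_eqP => -[b1 [i1 ik1]] [b2 [i2 ik2]].
rewrite !inE /tdom !negbK /= => /andP[-> h1] /andP[-> h2].
by congr (_, _); apply: val_inj => /=; case: kh => kE; lia.
Qed.

End Transversal.

(** * Starting squares of even and odd order *)

Section BaseSquare.
Variables (T : finType) (n : nat).
Hypothesis cT : #|T| = n.
Variables (Z : finComNzRingType) (iota : bool * Z -> T).
Hypothesis iotaI : injective iota.
Local Notation K := (bool * Z)%type.

Definition holed_table (dom : {set K}) (f : K -> K) (new i j : T) : option T :=
  match [pick u | iota u == i], [pick v | iota v == j] with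
  | Some u, Some v =>
      Some (if (u \in dom) && (v == f u) then new else iota (dop u v))
  | _, _ => None
  end.

Let pick_iota u : [pick u' | iota u' == iota u] = Some u.
Proof. by case: pickP => [u' /eqP/iotaI-> //|/(_ u)]; rewrite eqxx. Qed.

(** For even n the table itself is taken. For odd n a new symbol replaces the entries of a near
    transversal: each old symbol is lost at most once and the new one occurs at least #|K| - 1
    times, which is Ryser's condition for n = #|K| + 1. X consists of the row and column outside the
    table and of the replaced cells. *)
Lemma base_square (dom : {set K}) (f : K -> K) (new : T) :
  {in dom &, injective f} ->
  {in dom &, injective (fun u => dop u (f u))} ->
  (n = #|{: K}| /\ dom = set0) \/
    [/\ n = #|{: K}|.+1, new \notin codom iota & #|{: K}| <= #|dom|.+1] ->
  exists L (X : {set T * T}), [/\ latin L, dihedral_off iota X L & #|X| <= 3 * n].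
Proof.
move=> fI symI cases.
pose P := holed_table dom f new.
have PE u v : P (iota u) (iota v) =
    Some (if (u \in dom) && (v == f u) then new else iota (dop u v)).
  by rewrite /P /holed_table !pick_iota.
have PN i j : P i j != None -> exists u v, i = iota u /\ j = iota v.
  rewrite /P /holed_table; case: pickP => // u /eqP <-; case: pickP => // v /eqP <- _.
  by exists u, v.
have new_out u : u \in dom -> forall w, iota w <> new.
  by case: cases => [[_ ->]|[_ nN _]] ud w E; [rewrite inE in ud | rewrite -E codom_f in nN].
pose Co := [set iota u | u in [set: K]].
have cCo : #|Co| = #|{: K}| by rewrite card_imset // cardsT.
have plP : platin P.
  split=> [i j1 j2 t|j i1 i2 t] E1 E2.
    have [u [v1 [Ei Ej1]]] : exists u v, i = iota u /\ j1 = iota v by apply: PN; rewrite E1.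
    have [u' [v2 [Ei' Ej2]]] : exists u v, i = iota u /\ j2 = iota v by apply: PN; rewrite E2.
    have Eu : u' = u by apply: iotaI; rewrite -Ei'.
    subst; move: E1 E2; rewrite !PE => -[<-] [].
    case: ifP => [/andP[ud /eqP->]|_]; case: ifP => [/andP[ud' /eqP->]|_] //.
    - by move=> E; case: (new_out _ ud _ (esym E)).
    - by move=> E; case: (new_out _ ud' _ E).
    - by move=> /iotaI/dopIr ->.
  have [u1 [v [Ei1 Ej]]] : exists u v, i1 = iota u /\ j = iota v by apply: PN; rewrite E1.
  have [u2 [v' [Ei2 Ej']]] : exists u v, i2 = iota u /\ j = iota v by apply: PN; rewrite E2.
  have Ev : v' = v by apply: iotaI; rewrite -Ej'.
  subst; move: E1 E2; rewrite !PE => -[<-] [].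
  case: ifP => [/andP[ud /eqP E]|_]; case: ifP => [/andP[ud' /eqP E']|_] //.
  - by move=> _; congr iota; apply: fI => //; rewrite -E'.
  - by move=> Q; case: (new_out _ ud _ (esym Q)).
  - by move=> Q; case: (new_out _ ud' _ Q).
  - by move=> /iotaI/dopIl ->.
have fP : filled_on Co Co P.
  move=> i j; apply/idP/andP => [/PN[u [v [-> ->]]]|[/imsetP[u _ ->] /imsetP[v _ ->]]].
    by split; apply: imset_f; rewrite inE.
  by rewrite PE.
have occP t : #|Co| + #|Co| <= occ P t + n.
  rewrite cCo; have [tC|tC] := boolP (t \in codom iota).
    case/codomP: tC => s ->.
    pose good := [set u | ~~ ((u \in dom) && (ldiv u s == f u))].
    have le_occ : #|good| <= occ P (iota s).
      rewrite -(@card_imset _ _ (fun u => (iota u, iota (ldiv u s)))); last first.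
        by move=> u1 u2 [/iotaI].
      apply: subset_leq_card; apply/subsetP=> x /imsetP[u]; rewrite /good !inE => gu ->.
      by rewrite /= PE (negPf gu) dop_ldiv.
    have cC : #|good| + #|~: good| = #|{: K}| by exact: cardsC.
    have : #|~: good| <= #|dom| by apply: subset_leq_card; apply/subsetP=> u; rewrite !inE negbK => /andP[].
    have : #|~: good| <= 1.
      apply/card_le1_eqP => u1 u2; rewrite !inE !negbK => /andP[d1 /eqP E1] /andP[d2 /eqP E2].
      by apply: symI; rewrite // -E1 -E2 !dop_ldiv.
    case: cases => [[nE ->]|[nE _ _]]; rewrite ?cards0; lia.
  case: cases => [[nE _]|[nE nN leD]].
    have [g _ gK] := @inj_card_bij _ _ iota iotaI (eq_leq (etrans cT nE)).
    by rewrite -(gK t) codom_f in tC.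
  suff le_occ : #|dom| <= occ P t by lia.
  have -> : t = new.
    apply/eqP; apply: contraT => tn.
    have /card_le1_eqP h : #|~: Co| <= 1 by have := cardsC Co; rewrite cT cCo nE; lia.
    have outC i : i \notin codom iota -> i \in ~: Co.
      by rewrite inE; apply: contra => /imsetP[u _ ->]; rewrite codom_f.
    by rewrite (h t new) ?eqxx ?outC in tn.
  rewrite -(@card_imset _ _ (fun u => (iota u, iota (f u)))); last by move=> u1 u2 [/iotaI].
  apply: subset_leq_card; apply/subsetP=> x /imsetP[u ud ->].
  by rewrite inE /= PE ud eqxx.
have [L lL LP] := ryser cT plP fP occP.
pose X := setX (~: Co) setT :|: setX setT (~: Co) :|:
  [set (iota u, iota (f u)) | u in dom].
exists L, X; split=> //.
  move=> i j; rewrite !inE !negb_or !andbT !negbK /= => /andP[/andP[/imsetP[u _ ->] /imsetP[v _ ->]] nd].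
  exists u, v; split=> //; apply: LP; rewrite PE; case: ifP => // /andP[ud /eqP E].
  by case/negP: nd; rewrite E imset_f.
have cC : #|~: Co| <= 1.
  by have := cardsC Co; rewrite cT cCo; case: cases => [[-> _]|[-> _ _]]; lia.
have leK : #|{: K}| <= n by case: cases => [[-> _]|[-> _ _]]; lia.
have -> : 3 * n = n + n + n by lia.
apply: card_setU_le; first apply: card_setU_le.
- by rewrite cardsX cardsT cT -[leqRHS]mul1n leq_mul2r cC orbT.
- by rewrite cardsX cardsT cT -[leqRHS]muln1 leq_mul2l cC orbT.
by apply: leq_trans (leq_imset_card _ _) (leq_trans (max_card _) leK).
Qed.

End BaseSquare.

Lemma near_dihedral_square (T : finType) (n : nat) : #|T| = n -> 4 <= n ->
  exists (k' : nat) (iota : bool * 'I_k'.+2 -> T) L (X : {set T * T}),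
  [/\ injective iota, latin L, dihedral_off iota X L, #|X| <= 3 * n & n <= (k'.+2).*2.+1].
Proof.
(* The cyclic ring then has n./2 elements, at least two because n is at least 4. *)
move=> cT n4; pose k' := n./2 - 2.
have nE : n = odd n + (k'.+2).*2 by rewrite -{1}[n]odd_double_half /k'; lia.
have cK : #|{: bool * 'I_k'.+2}| = (k'.+2).*2.
  by rewrite card_prod card_bool card_ord mul2n.
have [iota iotaI] : exists f : bool * 'I_k'.+2 -> T, injective f.
  by apply: card_inj_exists; rewrite cK cT [leqRHS]nE leq_addl.
exists k', iota.
suff [L [X [lL dL cX]]] : exists L (X : {set T * T}),
    [/\ latin L, dihedral_off iota X L & #|X| <= 3 * n].
  by exists L, X; split=> //; rewrite {1}nE; case: (odd n).
case: (boolP (odd n)) => on; rewrite ?on ?(negPf on) in nE.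
  have : ~~ [forall i, i \in codom iota].
    apply/negP => /forallP cod.
    have sub : [set: T] \subset [set iota u | u in [set: bool * 'I_k'.+2]].
      by apply/subsetP=> i _; have /codomP[u ->] := cod i; rewrite imset_f ?inE.
    have := leq_trans (subset_leq_card sub) (leq_imset_card _ _).
    by rewrite !cardsT cT cK; lia.
  case/forallPn=> new nnew.
  apply: (@base_square _ _ cT _ _ iotaI [set u | tdom u] (@tcol k') new).
  - by move=> u1 u2; rewrite !inE; apply: tcol_inj.
  - by move=> u1 u2; rewrite !inE; apply: tsym_inj.
  right; split=> //; first by rewrite cK.
  by rewrite cK -addnn card_tdom.
apply: (@base_square _ _ cT _ _ iotaI set0 (@tcol k') (iota (false, 0%R))).
- by move=> u1 u2; rewrite inE.
- by move=> u1 u2; rewrite inE.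
by left; rewrite cK.
Qed.

(** * Sparse partial Latin squares *)

Section Main.
Variables (T : finType) (n : nat).
Hypothesis cT : #|T| = n.

Lemma symbol_load_sload (Z : finComNzRingType) (iota : bool * Z -> T) :
  injective iota -> symbol_load (sload iota).
Proof.
move=> iotaI; split=> [D|D F s].
  pose W := [set p : (bool * Z) * (bool * Z) | (iota p.1, iota p.2) \in D].
  apply: (@leq_trans #|W|); last first.
    have WD : #|[set p in [set: (bool * Z) * (bool * Z)] | (iota p.1, iota p.2) \in D]| <= #|D|.
      by apply: card_preim_le => -[u1 v1] [u2 v2] _ _ /= [/iotaI -> /iotaI ->].
    by apply: leq_trans WD; apply: subset_leq_card; apply/subsetP=> p; rewrite !inE.
  rewrite -[leqRHS]sum1_card (partition_big (fun p => iota (dop p.1 p.2)) predT) //=.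
  apply: leq_sum => s _; rewrite sum1_card; apply: subset_leq_card.
  by apply/subsetP=> p; rewrite !inE unfold_in /= inE.
pose W := [set p in [set: (bool * Z) * (bool * Z)] | (iota p.1, iota p.2) \in F].
have leW : #|W| <= #|F|.
  by apply: card_preim_le => -[u1 v1] [u2 v2] _ _ /= [/iotaI -> /iotaI ->].
apply: leq_trans (card_setU_le (leqnn (sload iota D s)) leW).
apply: subset_leq_card; apply/subsetP=> p; rewrite !inE => /andP[/orP[->|->]] -> //.
by rewrite orbT.
Qed.

(** Here K = k - 316 and h = n - 2e - 325. For n at least 5205, 8K + 14n is at most 40K, h is at
    least 3n/4 and Dn + 3n is at most 77N. So X is at most 4 * 3080 (n - 12e) / (21 * 1487), which
    is below 2(n - 12e)/5 for positive n - 12e. *)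
Lemma relocation_arith k e N Dn X :
  5 * 1041 <= n -> n < 2 * N -> n <= k.*2.+1 -> 12 * e < n -> 7 * 1487 * N <= n * (n - 12 * e) ->
  Dn <= 65 * N + 3 * n ->
  X * (n - 2 * e - 325) * (k - 316) <= (8 * (k - 316) + 14 * n) * (Dn + 3 * n) ->
  7 * e + 2 * X + 5 < n.
Proof.
move=> n5 nN nk en Nn leD leX.
have K0 : 0 < k - 316 by lia.
have lK : 8 * (k - 316) + 14 * n <= 40 * (k - 316) by lia.
have lD : Dn + 3 * n <= 77 * N by lia.
have lXh : X * (n - 2 * e - 325) <= 40 * (77 * N).
  by rewrite -(leq_pmul2r K0) (leq_trans leX) // (leq_trans (leq_mul lK lD)) // mulnAC.
have lh : 3 * n <= 4 * (n - 2 * e - 325) by lia.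
have l1 : X * (3 * n) <= 4 * (40 * (77 * N)).
  by apply: leq_trans (leq_mul (leqnn X) lh) _; rewrite mulnCA leq_mul2l.
have l2 : 21 * 1487 * X <= 4 * 3080 * (n - 12 * e).
  have n0 : 0 < n by lia.
  rewrite -(leq_pmul2l n0).
  have : 7 * 1487 * (X * (3 * n)) <= 4 * 3080 * (7 * 1487 * N).
    by apply: leq_trans (leq_mul (leqnn _) l1) _; clear; lia.
  move/leq_trans => /(_ _ (leq_mul (leqnn (4 * 3080)) Nn)).
  rewrite (_ : 7 * 1487 * (X * (3 * n)) = n * (21 * 1487 * X)); first by rewrite [leqRHS]mulnCA.
  by clear; lia.
by move: n5 en l2; clear; lia.
Qed.

(* 7 * 1487 = 10409; as a single nat literal it would not be a unary numeral. *)
Theorem sparse_completion (P : T -> T -> option T) e : platin P ->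
  (forall i, #|[set j | P i j != None]| <= e) ->
  (forall j, #|[set i | P i j != None]| <= e) ->
  (forall s, occ P s <= e) -> 12 * e < n ->
  7 * 1487 * #|[set x : T * T | P x.1 x.2 != None]| <= n * (n - 12 * e) ->
  has_completion P.
Proof.
set F := [set x : T * T | _] => plP rP cP oP en; set N := #|F| => Nn.
have [nN|nN] := leqP (2 * N) n; first exact: (few_filled_completion cT).
(* From n < 2N and 10409 N at most n^2, 2n exceeds 10409, so n is at least 5205. *)
have n5 : 5 * 1041 <= n.
  have : 7 * 1487 * N <= n * n by apply: leq_trans Nn _; rewrite leq_mul2l leq_subr orbT.
  move: nN; clear; nia.
have [|k' [iota [L0 [X [iotaI lL0 dL0 cX nk]]]]] := near_dihedral_square cT.
  by apply: leq_trans n5.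
set k := k'.+2 in iota iotaI dL0 nk.
pose bad (L : T -> T -> T) := [set x : T * T |
  ~~ [exists u, exists v, [&& iota u == x.1, iota v == x.2 & L x.1 x.2 == iota (dop u v)]]].
pose dis (L : T -> T -> T) := [set x in F | P x.1 x.2 != Some (L x.1 x.2)].
(* m bounds the number of filled cells still wrong. A correction disturbs at most 64 cells and
   lowers m by one, so [#|bad L| + 64 * m] never grows. *)
have main m L : latin L -> #|dis L| <= m -> #|bad L| + 64 * m <= 3 * n + 64 * N ->
    has_completion P.
  elim: m L => [|m IH] L lL cdis cbad.
    exists L => // i j s Pij; move: cdis; rewrite leqn0 cards_eq0 => /eqP/setP/(_ (i, j)).
    by rewrite !inE /= Pij /= => /eqP[].
  have [d0|/set0Pn[[r c]]] := eqVneq (dis L) set0.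
    by apply: (IH L) => //; [rewrite d0 cards0 | lia].
  rewrite !inE /= => /andP[/filledP[s Prc]]; rewrite Prc => nes.
  have {}nes : L r c != s by apply: contra nes => /eqP->.
  pose Pc := [set x : T * T | P x.1 x.2 == Some (L x.1 x.2)].
  pose D := F :|: bad L.
  have PcF : Pc \subset F by apply/subsetP=> x; rewrite !inE => /eqP->.
  have dD : dihedral_off iota D L.
    move=> i j; rewrite !inE negb_or negbK negbK /= => /andP[_ /existsP[u /existsP[v]]].
    by case/and3P=> /eqP<- /eqP<- /eqP E; exists u, v.
  have put : putable L D (sload iota) k.
    move=> D' R C S sub n1 n2 n3 lt; have cZ : #|'I_k| = k by rewrite card_ord.
    rewrite -cZ in lt; apply: (light_put iotaI lL _ n1 n2 n3 lt).
    by move=> i j nij; apply: dD; apply: contra nij; apply: (subsetP sub).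
  have cD : #|D| <= 65 * N + 3 * n.
    have := card_setU_le (leqnn #|F|) (leqnn #|bad L|); rewrite -/D -/N.
    by move: cbad; clear; lia.
  have [|||||||||Tr [L' [t dTr cTr L'rc]]] := @put_cell T n cT L D Pc (sload iota) k (k - 316)
      (n - 2 * e - 325) e r c s lL (subset_trans PcF (subsetUl _ _))
      (symbol_load_sload iotaI) put nes.
  - by rewrite inE /= Prc; apply: contra nes => /eqP[->].
  (* If the s of row r were already correct, P would contain s twice in that row. *)
  - rewrite inE /= clK //; apply/negP=> /eqP E; case/negP: nes.
    by rewrite (plP.1 _ _ _ _ Prc E) clK.
  - rewrite inE /= rwK //; apply/negP=> /eqP E; case/negP: nes.
    by rewrite {1}(plP.2 _ _ _ _ Prc E) rwK.
  - move=> i; apply: leq_trans (rP i); apply: subset_leq_card.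
    by apply/subsetP=> j; rewrite !inE => /eqP /= ->.
  - move=> j; apply: leq_trans (cP j); apply: subset_leq_card.
    by apply/subsetP=> i; rewrite !inE => /eqP /= ->.
  - move=> s'; apply: leq_trans (oP s'); apply: subset_leq_card.
    by apply/subsetP=> x; rewrite !inE => /andP[/eqP-> /eqP->].
  - by move: n5 nk; clear; lia.
  - by move: n5 en; clear; lia.
  - by move=> X'; apply: (relocation_arith n5 nN nk en Nn cD).
  (* Correct cells are untouched, so no filled cell becomes wrong while (r, c) is mended. *)
  have agree x : x \in Pc -> L' x.1 x.2 = L x.1 x.2.
    by case: x => i j xP; rewrite t.2 // (disjointFl dTr xP).
  apply: (IH L' t.1).
    have rcd : (r, c) \in dis L by rewrite !inE /= Prc /=; apply: contra nes => /eqP[->].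
    rewrite -ltnS; apply: leq_trans cdis; apply: proper_card; apply/properP; split.
      apply/subsetP=> x; rewrite !inE => /andP[-> /=]; apply: contra => xP.
      by rewrite agree ?inE.
    by exists (r, c) => //; rewrite !inE /= Prc L'rc eqxx andbF.
  have : #|bad L'| <= #|bad L| + 64.
    apply: leq_trans (card_setU_le (leqnn _) cTr); apply: subset_leq_card.
    apply/subsetP=> -[i j]; rewrite in_setU; have [_|nT] := boolP ((i, j) \in Tr).
      by rewrite orbT.
    by rewrite orbF !inE /= (t.2 _ _ nT).
  by move: cbad; clear; lia.
apply: (main N L0) => //.
  by apply: subset_leq_card; apply/subsetP=> x; rewrite inE => /andP[].
rewrite leq_add2r; apply: leq_trans cX; apply: subset_leq_card.
apply/subsetP=> -[i j]; rewrite !inE /=; apply: contraR => /dL0[u [v [-> -> ->]]].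
by apply/existsP; exists u; apply/existsP; exists v; rewrite !eqxx.
Qed.

End Main.

(** * Passage to real densities and matrices *)

Import Order.TTheory GRing.Theory Num.Theory.
Local Open Scope ring_scope.

Theorem theorem2p4p4 (R : realType) (eps delta : R)
    (heps0 : 0 <= eps) (hdelta0 : 0 <= delta)
    (heps : eps < 1 / 12%:R)
    (hdelta : delta < (1 - 12%:R * eps) ^+ 2 / 10409%:R)
    (n : nat) (hn : (0 < n)%N) (P : 'M[option 'I_n]_n)
    (hP : partial_latin_square P)
    (hdense : eps_dense eps P)
    (hfilled : #|filled_cells P|%:R <= delta * n%:R ^+ 2) :
  completable P.
Proof.
have n0 : 0 < n%:R :> R by rewrite ltr0n.
have en0 : 0 <= eps * n%:R by rewrite mulr_ge0 // ltW.
(* The counts are integers, so rounding the density bound down loses nothing. *)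
pose e := Num.truncn (eps * n%:R).
have ee : e%:R <= eps * n%:R by rewrite /e truncn_le.
have eps12 : 12 * eps < 1.
  by move: heps; rewrite ltr_pdivlMr ?ltr0n // mulrC.
have en : (12 * e < n)%N.
  rewrite -(ltr_nat R) natrM.
  apply: (@le_lt_trans _ _ (12 * (eps * n%:R))).
    by rewrite ler_pM2l.
  by rewrite mulrA gtr_pMl.
have le_e (m : nat) : m%:R <= eps * n%:R -> (m <= e)%N by rewrite /e truncn_ge_nat.
have [dr dc ds] := hdense.
have [|i|j|s|||L [lL1 lL2] LP] := @sparse_completion _ n (card_ord n) (fun i j => P i j) e.
- exact: hP.
- exact: le_e.
- exact: le_e.
- by apply: le_e; apply: ds.
- exact: en.
- have -> : (7 * 1487 = 10409)%N by vm_compute.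
  rewrite -(ler_nat R) !natrM natrB 1?ltnW // natrM.
  (* As 1 - 12 eps lies between 0 and 1, its square is at most itself; e at most eps n then turns (1
     - 12 eps) n^2 into a lower bound for n (n - 12e). *)
  have d1 : 10409%:R * delta <= 1 - 12 * eps.
    move: hdelta; rewrite ltr_pdivlMr ?ltr0n // mulrC => /ltW/le_trans; apply.
    by rewrite expr2 ler_piMl ?subr_ge0 ?(ltW eps12) // gerBl mulr_ge0.
  apply: (@le_trans _ _ (10409%:R * (delta * n%:R ^+ 2))).
    by rewrite ler_pM2l ?ltr0n.
  rewrite mulrA expr2 mulrA mulrC ler_pM2l //.
  apply: le_trans (ler_wpM2r (ltW n0) d1) _.
  by rewrite mulrBl mul1r lerB // -mulrA ler_pM2l.
exists (\matrix_(i, j) L i j); split; first split.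
- by move=> i j1 j2; rewrite !mxE => /lL1.
- by move=> j i1 i2; rewrite !mxE => /lL2.
by move=> i j s E; rewrite mxE; apply: LP.
Qed.
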